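(* Let $\mathcal G<E(d)$ be a discrete group in normal form, $x_0\in\mathbb R^d$ with $\mathcal G\cdot x_0\ne\{x_0\}$, $V$ an interaction potential with finite interaction range, $E$ its configurational energy, and $\mathcal R\subset\mathcal G$ an admissible neighborhood range of $id$. Suppose that $V'(y_0)=0$, where $y_0=(g\cdot x_0-x_0)_{g\in\mathcal G_\sim^*}$. Then the bilinear form $E''(\chi_{\mathcal G}x_0)$ is bounded with respect to $\|\cdot\|_{\mathcal R}$. In particular, $\lambda_{\mathrm a}\in\mathbb R$ and $\lambda_{\mathrm a,0,0}\in\mathbb R$.
   Context: Group setting. $\mathbb N=\{1,2,\dots\}$. $E(d)=O(d)\ltimes\mathbb R^d$ is the Euclidean group with product $(A_1,b_1)(A_2,b_2)=(A_1A_2,b_1+A_1b_2)$, acting on $\mathbb R^d$ by $(A,b)\cdot x=Ax+b$; $L((A,b))=A$, $\tau((A,b))=b$, and $id$ is the identity element. A subgroup of $E(d)$ is discrete if all its orbits in $\mathbb R^d$ are discrete. A $d_2$-dimensional space group is a discrete subgroup of $E(d_2)$ containing $d_2$ translations with linearly independent translation components. Normal form: $d=d_1+d_2$ with $d_1,d_2\in\mathbb N_0$, $\mathcal S$ is a $d_2$-dimensional space group, and $\mathcal G<E(d)$ is a discrete group all of whose elements are of the form $A\oplus s:=\left(\begin{pmatrix}A&0\\0&L(s)\end{pmatrix},\begin{pmatrix}0\\ \tau(s)\end{pmatrix}\right)$ with $A\in O(d_1)$, $s\in\mathcal S$, such that $\pi:\mathcal G\to\mathcal S$, $A\oplus s\mapsto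 s$, is surjective (every discrete group has this form up to conjugation in $E(d)$). $\mathcal T\subset\mathcal G$ is a fixed set mapped bijectively by $\pi$ onto the subgroup $\mathcal T_{\mathcal S}$ of translations of $\mathcal S$. For $N\in\mathbb N$, $\mathcal T^N:=\{t^N: t\in\mathcal T\}$, and $M_0:=\{N\in\mathbb N:\mathcal T^N\text{ is a normal subgroup of }\mathcal G\}$; it is known that $M_0=m_0\mathbb N$ for some $m_0\in\mathbb N$ and that $\mathcal T^N$ has finite index in $\mathcal G$ for $N\in M_0$. $\mathcal C_N$ is a fixed set of representatives of $\mathcal G/\mathcal T^N$. A function $u$ on $\mathcal G$ is $\mathcal T^N$-periodic if $u(gt)=u(g)$ for all $g\in\mathcal G,t\in\mathcal T^N$, and periodic if it is $\mathcal T^N$-periodic for some $N\in M_0$. $U_{\mathrm{per}}$ is the space of periodic functions $\mathcal G\to\mathbb R^d$. Structure. $x_0\in\mathbb R^d$, $\mathcal G_{x_0}$ is the (finite) stabilizer of $x_0$ in $\mathcal G$, $d_{\mathrm{aff}}$ is the dimension of the affine hull $\mathrm{aff}(\mathcal G\cdot x_0)$. Coordinates are normalized so that $\mathrm{aff}(\mathcal G\cdot x_0)=\{0_{d-d_{\mathrm{aff}}}\}\times\mathbb R^{d_{\mathrm{aff}}}$ and every $g\in\mathcal G$ acts trivially on the first $d-d_{\mathrm{aff}}$ coordinates. $\mathcal G_\sim:=\mathcal G/\mathcal G_{x_0}$ (left cosets), $\mathcal G_\sim^*:=\mathcal G_\sim\setminus\{\mathcal G_{x_0}\}$. For $\mathcal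 R\subset\mathcal G$ with $\mathcal R\mathcal G_{x_0}=\mathcal R$ and $u:\mathcal R\to\mathbb R^d$ put $\bar u(g):=\frac1{|\mathcal G_{x_0}|}\sum_{h'\in\mathcal G_{x_0}}L(h')u(gh')$. Seminorms. $\mathcal R\subset\mathcal G$ is an admissible neighborhood range of $id$ if $\mathcal R$ is finite, $\mathcal R\mathcal G_{x_0}=\mathcal R$ and there are $\mathcal R',\mathcal R''\subset\mathcal G$ with $\mathcal R'\mathcal R''\subset\mathcal R$, $id\in\mathcal R'\cap\mathcal R''$, $\mathcal R'$ generating $\mathcal G$, and $\mathrm{aff}(\mathcal R''\cdot x_0)=\mathrm{aff}(\mathcal G\cdot x_0)$. $\mathrm{Skew}(d)$ is the space of real skew-symmetric $d\times d$ matrices, $\mathrm{Skew}_{0,0}(d)$ the subspace of those whose entries outside the upper left $d_1\times d_1$ block vanish. $U_{\mathrm{iso}}(\mathcal R)$ is the space of $u:\mathcal R\to\mathbb R^d$ for which there are $a\in\mathbb R^d$, $S\in\mathrm{Skew}(d)$ with $L(g)\bar u(g)=a+S(g\cdot x_0-x_0)$ for all $g\in\mathcal R$; $U_{\mathrm{iso},0,0}(\mathcal R)$ is defined likewise with $S\in\mathrm{Skew}_{0,0}(d)$. With $\|v\|^2=\sum_{h\in\mathcal R}\|v(h)\|^2$ on $(\mathbb R^d)^{\mathcal R}$ and $\pi_U$ the orthogonal projection of $(\mathbb R^d)^{\mathcal R}$ with kernel $U$, for $\mathcal T^N$-periodic $u\in U_{\mathrm{per}}$: $\|u\|_{\mathcal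 R}^2=\frac1{|\mathcal C_N|}\sum_{g\in\mathcal C_N}\|\pi_{U_{\mathrm{iso}}(\mathcal R)}(u(g\,\cdot)|_{\mathcal R})\|^2$ and $\|u\|_{\mathcal R,0,0}^2=\frac1{|\mathcal C_N|}\sum_{g\in\mathcal C_N}\|\pi_{U_{\mathrm{iso},0,0}(\mathcal R)}(u(g\,\cdot)|_{\mathcal R})\|^2$. Energy. An interaction potential is a function $V:(\mathbb R^d)^{\mathcal G_\sim^*}\to\mathbb R$ such that (H1) $V(Ry)=V(y)$ for all $R\in O(d)$ and all $y$; (H2) for every $y:\mathcal G_\sim^*\to\mathbb R^d$ the map $L^\infty(\mathcal G_\sim^*,\mathbb R^d)\to\mathbb R$, $z\mapsto V(y+z)$, is twice continuously Fréchet differentiable (sup norm), with derivatives denoted $V'(y),V''(y)$; (H3) with $(\partial_gV(y))_i=V'(y)(\delta_ge_i)$ (row vector) and $(\partial_g\partial_hV(y))_{ij}=V''(y)(\delta_ge_i,\delta_he_j)$, where $\delta_g$ is the indicator function of $\{g\}$ on $\mathcal G_\sim^*$, one has $\sum_g\|\partial_gV(y)\|<\infty$ and $\sum_{g,h}\|\partial_g\partial_hV(y)\|<\infty$. $V$ has finite interaction range if there is a finite $\tilde{\mathcal R}_V\subset\mathcal G_\sim^*$ with $V(y)=V(\chi_{\tilde{\mathcal R}_V}y)$ for all $y$ ($\chi$ = indicator function); then (H3) is automatic. The configurational energy $E:U_{\mathrm{per}}\to\mathbb R$ is $$E(w)=\frac1{|\mathcal C_N|}\sum_{g\in\mathcal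 C_N}V\Big(\Big(\tfrac1{|\mathcal G_{x_0}|}\sum_{h'\in h}(gh')\cdot w(gh')-\tfrac1{|\mathcal G_{x_0}|}\sum_{h'\in\mathcal G_{x_0}}(gh')\cdot w(gh')\Big)_{h\in\mathcal G_\sim^*}\Big)$$ for $\mathcal T^N$-periodic $w$; it is twice continuously Fréchet differentiable for $\|\cdot\|_\infty$. $\chi_{\mathcal G}x_0$ is the constant function with value $x_0$. Stability constants. $\lambda_{\mathrm a}:=\sup\{c\in\mathbb R: c\|u\|_{\mathcal R}^2\le E''(\chi_{\mathcal G}x_0)(u,u)\ \forall u\in U_{\mathrm{per}}\}$, and $\lambda_{\mathrm a,0,0}$ is defined likewise with $\|\cdot\|_{\mathcal R,0,0}$ ($\sup\emptyset=-\infty$). A bilinear form $B$ on a real vector space $W$ is bounded with respect to a seminorm $\|\cdot\|$ if there is $C>0$ with $|B(v,w)|\le C\|v\|\|w\|$ for all $v,w\in W$. *)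

(* Defs.v *)
From HB Require Import structures.
From mathcomp Require Import all_boot all_order all_algebra finmap.
From mathcomp Require Import all_classical all_reals all_analysis.

Set Implicit Arguments.
Unset Strict Implicit.
Unset Printing Implicit Defensive.

Import Order.TTheory GRing.Theory Num.Theory.
Import numFieldNormedType.Exports.

Local Open Scope classical_set_scope.
Local Open Scope ring_scope.

Definition orthogonal_mx (R : realType) (d : nat) (A : 'M[R]_d) : bool :=
  A^T *m A == 1%:M.

Record euclid (R : realType) (d : nat) := Euclid {
  euclid_val : 'M[R]_d * 'cV[R]_d;
  _ : orthogonal_mx euclid_val.1 }.

HB.instance Definition _ (R : realType) (d : nat) :=
  [isSub for @euclid_val R d].
HB.instance Definition _ (R : realType) (d : nat) :=
  [Choice of euclid R d by <:].

Section EuclideanGroup.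
Context {R : realType} {d : nat}.
Implicit Types g h : euclid R d.

(** The maps [L] and [tau], and the action [(A, b) . x = A x + b]. *)
Definition lin g : 'M[R]_d := (euclid_val g).1.
Definition trans g : 'cV[R]_d := (euclid_val g).2.
Definition act g (x : 'cV[R]_d) : 'cV[R]_d := lin g *m x + trans g.

Lemma linP g : (lin g)^T *m lin g = 1%:M.
Proof. by apply/eqP; exact: (valP g). Qed.

Lemma euclidP g h : lin g = lin h -> trans g = trans h -> g = h.
Proof.
move=> gh1 gh2; apply/val_inj => /=.
by rewrite /lin /trans in gh1 gh2; rewrite (surjective_pairing (euclid_val g)) gh1 gh2 -surjective_pairing.
Qed.

Fact euclid_one_subproof : orthogonal_mx (1%:M : 'M[R]_d).
Proof. by rewrite /orthogonal_mx trmx1 mul1mx. Qed.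
Definition euclid_one : euclid R d :=
  @Euclid R d (1%:M, 0) euclid_one_subproof.

Fact euclid_mul_subproof g h : orthogonal_mx (lin g *m lin h).
Proof.
by rewrite /orthogonal_mx trmx_mul mulmxA -(mulmxA _ _ (lin g)) linP mulmx1 linP.
Qed.
Definition euclid_mul g h : euclid R d :=
  @Euclid R d (lin g *m lin h, trans g + lin g *m trans h)
    (euclid_mul_subproof g h).

Fact euclid_inv_subproof g : orthogonal_mx (lin g)^T.
Proof. by rewrite /orthogonal_mx trmxK; apply/eqP/mulmx1C/linP. Qed.
Definition euclid_inv g : euclid R d :=
  @Euclid R d ((lin g)^T, - ((lin g)^T *m trans g)) (euclid_inv_subproof g).

Fact euclid_mulA : associative euclid_mul.
Proof.
by move=> x y z; apply: euclidP; rewrite /lin /trans/= ?mulmxA// mulmxDr addrA mulmxA.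
Qed.
Fact euclid_mul1 : left_id euclid_one euclid_mul.
Proof. by move=> x; apply: euclidP; rewrite /lin /trans/= mul1mx ?add0r. Qed.
Fact euclid_mulr1 : right_id euclid_one euclid_mul.
Proof. by move=> x; apply: euclidP; rewrite /lin /trans/= ?mulmx1// mulmx0 addr0. Qed.
Fact euclid_mulV : left_inverse euclid_one euclid_inv euclid_mul.
Proof. by move=> x; apply: euclidP; rewrite /lin /trans/= ?linP// addNr. Qed.
Fact euclid_mulrV : right_inverse euclid_one euclid_inv euclid_mul.
Proof.
move=> x; apply: euclidP; rewrite /lin /trans/=; first exact/mulmx1C/linP.
by rewrite mulmxN mulmxA (mulmx1C (linP x)) mul1mx subrr.
Qed.

HB.instance Definition _ := isGroup.Build (euclid R d)
  euclid_mulA euclid_mul1 euclid_mulr1 euclid_mulV euclid_mulrV.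

End EuclideanGroup.

(** A subgroup of [E(d)] is a [G : groupClosed (euclid R d)]; its elements form
    the type [carrier G]. *)
Definition carrier (R : realType) (d : nat) (G : groupClosed (euclid R d)) :=
  {g : euclid R d | g \in G}.

Section Carrier.
Context (R : realType) (d : nat) (G : groupClosed (euclid R d)).
HB.instance Definition _ := Choice.on (carrier G).
HB.instance Definition _ := SubChoice.on (carrier G).
Fact carrier_closed : group_closed [in G].
Proof. by split=> [|x y]; [exact: gpred1 | exact: gpredF]. Qed.
HB.instance Definition _ :=
  @SubChoice_isSubGroup.Build (euclid R d) [in G] (carrier G) carrier_closed.
End Carrier.

(** Euclidean norm on vectors, Frobenius norm on matrices (the library's norm on
    matrices is the maximum norm). *)
Definition fnorm {R : realType} {m n : nat} (A : 'M[R]_(m, n)) : R :=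
  Num.sqrt (\sum_i \sum_j A i j ^+ 2).

Definition aff {R : realType} {d : nat} (A : set 'cV[R]_d) : set 'cV[R]_d :=
  [set x | exists n (c : 'I_n -> R) (p : 'I_n -> 'cV[R]_d),
    [/\ forall i, A (p i), \sum_i c i = 1 & x = \sum_i c i *: p i]].

Definition skew_mx {R : realType} {d : nat} : set 'M[R]_d :=
  [set S | S^T = - S].

Definition skew00_mx {R : realType} {d1 d2 : nat} : set 'M[R]_(d1 + d2) :=
  [set S | skew_mx S /\ exists S1 : 'M[R]_d1, S = block_mx S1 0 0 0].

(** The normed spaces needed below are subspaces [W] of a function space [X],
    normed by [N].  Derivatives are taken along [W]; they are total functions on
    [X] of which only the values on [W] are meaningful. *)
Section Frechet.
Context {R : realType} {X : lmodType R}.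
Variables (W : set X) (N : X -> R).

Definition linear_on (l : X -> R) : Prop :=
  forall (a : R) u v, W u -> W v -> l (a *: u + v) = a * l u + l v.

Definition bounded_linear (l : X -> R) : Prop :=
  linear_on l /\ exists C : R, forall u, W u -> `|l u| <= C * N u.

Definition bilinear_on (B : X -> X -> R) : Prop :=
  (forall v, W v -> linear_on (B ^~ v)) /\ (forall u, W u -> linear_on (B u)).

(** Used also with a seminorm in place of [N]. *)
Definition bounded_form (B : X -> X -> R) : Prop :=
  exists2 C : R, 0 < C & forall u v, W u -> W v -> `|B u v| <= C * N u * N v.

Definition is_frechet (f : X -> R) (x : X) (l : X -> R) : Prop :=
  bounded_linear l /\
  forall e : R, 0 < e -> exists2 r : R, 0 < r &
    forall z, W z -> N z < r -> `|f (x + z) - f x - l z| <= e * N z.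

Definition frechet (f : X -> R) (x : X) : X -> R :=
  xget (fun=> 0) [set l | is_frechet f x l].

(** [B] is the derivative at [x] of [frechet f], a map into the dual space of
    [W] with the operator norm. *)
Definition is_frechet2 (f : X -> R) (x : X) (B : X -> X -> R) : Prop :=
  [/\ bilinear_on B, bounded_form B &
  forall e : R, 0 < e -> exists2 r : R, 0 < r &
    forall z v, W z -> W v -> N z < r ->
      `|frechet f (x + z) v - frechet f x v - B z v| <= e * N z * N v].

Definition frechet2 (f : X -> R) (x : X) : X -> X -> R :=
  xget (fun _ _ => 0) [set B | is_frechet2 f x B].

Definition frechet_C2 (f : X -> R) : Prop :=
  forall x, W x ->
  [/\ is_frechet f x (frechet f x),
      is_frechet2 f x (frechet2 f x) &
      forall e : R, 0 < e -> exists2 r : R, 0 < r &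
        forall z, W z -> N z < r -> forall u v, W u -> W v ->
          `|frechet2 f (x + z) u v - frechet2 f x u v| <= e * N u * N v].

End Frechet.

Definition supnorm {R : realType} {d : nat} {I : Type} (u : I -> 'cV[R]_d) : R :=
  sup [set fnorm (u i) | i in setT].

Definition Linfty {R : realType} {d : nat} {I : Type} : set (I -> 'cV[R]_d) :=
  [set z | exists M : R, forall i, fnorm (z i) <= M].

Definition discrete_group {R : realType} {d : nat}
    (G : groupClosed (euclid R d)) : Prop :=
  forall x : 'cV[R]_d,
    let orbit := [set act g x | g in [set` G]] in orbit `<=` isolated orbit.

Definition is_translation {R : realType} {d : nat} : set (euclid R d) :=
  [set g | lin g = 1%:M].

Definition space_group {R : realType} {d : nat}
    (S : groupClosed (euclid R d)) : Prop :=
  discrete_group S /\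
  exists2 B : 'M[R]_d, row_free B &
    forall i, exists s, [/\ s \in S, is_translation s & trans s = (row i B)^T].

Section NormalForm.
Context {R : realType} {d1 d2 : nat}.
Variables (G : groupClosed (euclid R (d1 + d2))) (S : groupClosed (euclid R d2)).

(** [g = A (+) s] *)
Definition is_osum (A : 'M[R]_d1) (s : euclid R d2) (g : euclid R (d1 + d2)) :=
  lin g = block_mx A 0 0 (lin s) /\ trans g = col_mx 0 (trans s).

(** The graph of the projection [A (+) s |-> s]; [s] is determined by [g]. *)
Definition osum_proj (g : euclid R (d1 + d2)) (s : euclid R d2) : Prop :=
  exists2 A : 'M[R]_d1, orthogonal_mx A & is_osum A s g.

Definition normal_form : Prop :=
  [/\ space_group S, discrete_group G,
      forall g, g \in G -> exists2 s, s \in S & osum_proj g s &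
      forall s, s \in S -> exists2 g, g \in G & osum_proj g s].

(** [T] is mapped bijectively onto the translation subgroup of [S]. *)
Definition translation_lift (T : set (carrier G)) : Prop :=
  (forall t, T t -> exists s, [/\ s \in S, is_translation s & osum_proj (val t) s]) /\
  (forall s, s \in S -> is_translation s -> exists! t, T t /\ osum_proj (val t) s).

End NormalForm.

Section Periodic.
Context {R : realType} {d : nat} {G : groupClosed (euclid R d)}.
Implicit Types (H A : set (carrier G)) (u : carrier G -> 'cV[R]_d).

Definition is_subgroup H : Prop :=
  [/\ H 1%g, forall g h, H g -> H h -> H (g * h)%g & forall g, H g -> H g^-1%g].

Definition normal_subgroup H : Prop :=
  is_subgroup H /\ forall g h, H h -> H (g * h * g^-1)%g.

Definition generates A : Prop :=
  forall H, is_subgroup H -> A `<=` H -> H = setT.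

(** [C] contains exactly one element of each left coset of [H]. *)
Definition representatives H (C : set (carrier G)) : Prop :=
  forall g, exists! c, C c /\ exists2 h, H h & c = (g * h)%g.

Variable T : set (carrier G).

Definition powers (N : nat) : set (carrier G) := [set (t ^+ N)%g | t in T].

Definition M0 : set nat := [set N | (0 < N)%N /\ normal_subgroup (powers N)].

Definition periodic_wrt (N : nat) u : Prop :=
  forall g t, powers N t -> u (g * t)%g = u g.

Definition Uper : set (carrier G -> 'cV[R]_d) :=
  [set u | exists2 N, M0 N & periodic_wrt N u].

(** A period of [u], meaningful for [u] in [Uper]. *)
Definition period u : nat := xget 1%N [set N | M0 N /\ periodic_wrt N u].

Variable C : nat -> set (carrier G).

(** The mean over [C_N], for a period [N] of [u]. *)
Definition period_mean u (F : carrier G -> R) : R :=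
  (#|` fset_set (C (period u))|%:R)^-1 * \sum_(g \in C (period u)) F g.

End Periodic.

Section Orbit.
Context {R : realType} {d : nat} {G : groupClosed (euclid R d)}.
Variable x0 : 'cV[R]_d.

Definition orbit_of (A : set (carrier G)) : set 'cV[R]_d :=
  [set act (val g) x0 | g in A].

Definition stab : set (carrier G) := [set g | act (val g) x0 = x0].

Definition left_coset (g : carrier G) : set (carrier G) :=
  [set (g * h)%g | h in stab].

Definition cosets_star : set (set (carrier G)) :=
  [set left_coset g | g in setT] `\ stab.

(** The first equation determines [daff] as the dimension of the affine hull. *)
Definition normalized_coordinates (daff : nat) : Prop :=
  [/\ (daff <= d)%N,
      aff (orbit_of setT) =
        [set x : 'cV[R]_d | forall i : 'I_d, (i < d - daff)%N -> x i 0 = 0] &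
      forall (g : carrier G) (x : 'cV[R]_d) (i : 'I_d),
        (i < d - daff)%N -> act (val g) x i 0 = x i 0].

(** [f] summed over [A] and divided by the order of the stabilizer. *)
Definition stab_mean (A : set (carrier G)) (f : carrier G -> 'cV[R]_d) :
    'cV[R]_d :=
  (#|` fset_set stab|%:R)^-1 *: \sum_(h \in A) f h.

Definition ubar (u : carrier G -> 'cV[R]_d) (g : carrier G) : 'cV[R]_d :=
  stab_mean stab (fun h => lin (val h) *m u (g * h)%g).

Definition admissible (Rg : set (carrier G)) : Prop :=
  [/\ finite_set Rg,
      [set (g * h)%g | g in Rg & h in stab] = Rg &
      exists R1 R2 : set (carrier G),
        [/\ [set (g * h)%g | g in R1 & h in R2] `<=` Rg, (R1 `&` R2) 1%g,
            generates R1 & aff (orbit_of R2) = aff (orbit_of setT)]].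

End Orbit.
Arguments cosets_star {R d} G x0.
Arguments normalized_coordinates {R d} G x0 daff.

(** A map [Rg -> R^d] is represented by its extension by zero to [G]; the
    restriction of [u] is accordingly [u \_ Rg]. *)
Section Seminorms.
Context {R : realType} {d : nat} {G : groupClosed (euclid R d)}.
Implicit Types (u v : carrier G -> 'cV[R]_d) (U : set (carrier G -> 'cV[R]_d)).
Variable Rg : set (carrier G).

Definition maps_on : set (carrier G -> 'cV[R]_d) :=
  [set u | forall g, ~ Rg g -> u g = 0].

Definition dot_on u v : R := \sum_(h \in Rg) ((u h)^T *m v h) 0 0.

Definition norm_on u : R := Num.sqrt (\sum_(h \in Rg) fnorm (u h) ^+ 2).

(** [pi_U v], for the orthogonal projection of [maps_on] with kernel [U]. *)
Definition proj_ker U v : carrier G -> 'cV[R]_d :=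
  xget (fun=> 0) [set p | [/\ maps_on p, U (v - p) &
                              forall w, U w -> dot_on p w = 0]].

(** [U_iso(Rg)] and [U_iso,0,0(Rg)] for [K] the space [skew_mx] and [skew00_mx]. *)
Definition Uiso (K : set 'M[R]_d) (x0 : 'cV[R]_d) :
    set (carrier G -> 'cV[R]_d) :=
  [set u | maps_on u /\
    exists a : 'cV[R]_d, exists2 S : 'M[R]_d, K S &
      forall g, Rg g ->
        lin (val g) *m ubar x0 u g = a + S *m (act (val g) x0 - x0)].

Definition seminorm (T : set (carrier G)) (C : nat -> set (carrier G))
    (K : set 'M[R]_d) (x0 : 'cV[R]_d) u : R :=
  Num.sqrt (period_mean T C u (fun g =>
    norm_on (proj_ker (Uiso K x0) ((fun h => u (g * h)%g) \_ Rg)) ^+ 2)).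

End Seminorms.

Section Potential.
Context {R : realType} {d : nat} {G : groupClosed (euclid R d)} {x0 : 'cV[R]_d}.

Local Notation conf := (cosets_star G x0 -> 'cV[R]_d).

Variable V : conf -> R.
Implicit Types (y z : conf) (g h : cosets_star G x0).

Definition dV y : conf -> R :=
  frechet Linfty supnorm (fun z => V (y + z)) 0.

Definition d2V y : conf -> conf -> R :=
  frechet2 Linfty supnorm (fun z => V (y + z)) 0.

Definition delta g (v : 'cV[R]_d) : conf :=
  fun h => if h == g then v else 0.

Definition pdV y g : 'rV[R]_d :=
  \row_i dV y (delta g (delta_mx i 0)).

Definition pd2V y g h : 'M[R]_d :=
  \matrix_(i, j) d2V y (delta g (delta_mx i 0)) (delta h (delta_mx j 0)).

Definition interaction_potential : Prop :=
  [/\ forall (A : 'M[R]_d) y, orthogonal_mx A -> V (fun g => A *m y g) = V y,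
      forall y, frechet_C2 Linfty supnorm (fun z => V (y + z)) &
      forall y,
        summable setT (fun g => (fnorm (pdV y g))%:E) /\
        summable setT (fun gh : cosets_star G x0 * cosets_star G x0 =>
          (fnorm (pd2V y gh.1 gh.2))%:E)].

Definition finite_range : Prop :=
  exists2 RV : set (cosets_star G x0), finite_set RV &
    forall y, V y = V (y \_ RV).

(** [(g . x0 - x0)_g], which does not depend on the chosen representatives. *)
Definition y0 : conf :=
  fun c => act (val (xget 1%g (val c))) x0 - x0.

Variables (T : set (carrier G)) (C : nat -> set (carrier G)).

Definition energy (w : carrier G -> 'cV[R]_d) : R :=
  period_mean T C w (fun g : carrier G =>
    let moved (h : carrier G) := act (val (g * h)%g) (w (g * h)%g) in
    V (fun c => stab_mean x0 (val c) moved - stab_mean x0 (stab x0) moved)).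

Definition energy2 :
    (carrier G -> 'cV[R]_d) -> (carrier G -> 'cV[R]_d) -> R :=
  frechet2 (Uper T) supnorm energy (fun=> x0).

(** [lambda_a] and [lambda_a,0,0] for [K] the space [skew_mx] and [skew00_mx]; the
    supremum of the empty set is [-oo]. *)
Definition lambda_a (Rg : set (carrier G)) (K : set 'M[R]_d) : \bar R :=
  ereal_sup [set c%:E | c in [set c : R | forall u, Uper T u ->
    c * seminorm Rg T C K x0 u ^+ 2 <= energy2 u u]].

End Potential.
Arguments y0 {R d} G x0.

(* Main.v *)
(* Since [V] is invariant under rotations and [V'(y0) = 0], the Hessian [V''(y0)] is
   annihilated, in either argument, by [(S y0)] restricted to the finite range of [V], for
   every skew [S].  The second derivative of the energy is the mean over [g] of [V''(y0)]
   evaluated at the displacements of [u (g .)] and [v (g .)], so each displacement may be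
   corrected by an infinitesimal rotation depending on [g].  On the patch [g Rg] the field
   is close to an infinitesimal isometry up to the local defect at [g], which is the
   distance measured by the seminorm.  Neighbouring patches overlap in a set affinely
   spanning the affine hull of the orbit, hence their isometries agree up to the defects;
   since [R'] generates the group, the corrected displacement on the finite range of [V] is
   bounded by finitely many defects, and Cauchy-Schwarz together with the translation
   invariance of the mean gives the bound.

   The upper bound for the stability constants needs a periodic field of positive
   seminorm, hence arbitrarily sparse normal subgroups [T^N] of finite index.  The kernel [F]
   of [g |-> s] is finite; with [E = |F|!], the power map with exponent [E ^ 3] is a
   homomorphism on the preimage of the translations that factors through the lattice. *)
Require Import Defs.
From mathcomp Require Import all_boot all_order all_algebra finmap.
From mathcomp Require Import all_classical all_reals all_analysis.
From mathcomp Require Import zify ring lra.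

Set Implicit Arguments.
Unset Strict Implicit.
Unset Printing Implicit Defensive.

Import Order.TTheory GRing.Theory Num.Theory.
Import numFieldNormedType.Exports.
Local Open Scope classical_set_scope.
Local Open Scope ring_scope.

(** * Powers in extensions of an abelian group by a finite group *)

(** [energy2] is the [xget] of a specification, and differentiability of [energy] is not established
    here: the estimate is proved for whatever [energy2] returns, default values included.
    Derivatives are handled through difference quotients only.

    Symmetry of the Hessian is not part of [is_frechet2], so its two annihilation properties have
    separate proofs. On the left, the rotated equilibria form a curve of critical points. On the
    right, the identity [D x (S (y0 + x)) = 0], valid at every [x], is expanded to second order
    around [0].

    [T] is a mere set of lifts, closed neither under products nor under conjugation. An exponent
    that erases the finite kernel makes the choice of lifts irrelevant; this is why the power map is
    studied first. *)

Lemma iter_fact_fix (X : eqType) (s : seq X) (f : X -> X) (x : X) :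
  injective f -> {in s, forall y, f y \in s} -> x \in s ->
  iter (size s)`! f x = x.
Proof.
move=> finj fs xs.
have its k : iter k f x \in s by elim: k => //= k; exact: fs.
(* The trajectory stays in [s], hence repeats; injectivity cancels the preperiod, leaving a cycle
   through [x] whose length is at most [size s] and so divides its factorial. *)
have : looping f x (size s).
  rewrite -[looping _ _ _]negbK -looping_uniq; apply/negP => /uniq_leq_size.
  move=> /(_ s); rewrite size_traject ltnn => H; apply/notF/H => y.
  by case/trajectP => i _ ->.
case/trajectP => i lt_is eq_i.
have {}eq_i : iter (size s - i) f x = x.
  move: eq_i (subnK (ltnW lt_is)); move: (size s - i)%N => k + e; rewrite -{}e.
  rewrite addnC iterD; elim: i {lt_is} => //= i IH /finj; exact: IH.
have k0 : (0 < size s - i)%N by rewrite subn_gt0.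
have /dvdnP[q ->] : (size s - i %| (size s)`!)%N.
  by apply: dvdn_fact; rewrite k0 leq_subr.
by elim: q => //= q IH; rewrite mulSn iterD IH.
Qed.

Section PowerMap.
Context (gT : groupType) (H F : set gT).
Hypothesis Hone : H 1%g.
Hypothesis HM : forall x y, H x -> H y -> H (x * y)%g.
Hypothesis FM : forall x y, F x -> F y -> F (x * y)%g.
Hypothesis Fone : F 1%g.
Hypothesis FH : F `<=` H.
Hypothesis FJ : forall x f, F f -> F (f ^ x)%g.
Hypothesis FR : forall x y, H x -> H y -> F [~ x, y]%g.
Hypothesis Ffin : finite_set F.

Let E := (#|` fset_set F|)`!.

Let mem_F x : (x \in fset_set F) = (x \in F).
Proof. by rewrite in_fset_set. Qed.

Let HX x n : H x -> H (x ^+ n)%g.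
Proof. by move=> Hx; elim: n => [|n IH]; rewrite ?expg0// expgS; exact: HM. Qed.

Lemma expg_kernel f : F f -> (f ^+ E = 1)%g.
Proof.
move=> Ff; have := @iter_fact_fix _ (fset_set F) ( *%g f) f (@mulgI _ f).
rewrite iter_mulg => ff; apply: (@mulIg _ f); rewrite mul1g; apply: ff.
  by move=> y; rewrite !mem_F !inE; exact: FM.
by rewrite mem_F inE.
Qed.

(** Conjugation by [x] permutes the finite set [F], so its [E]-th iterate fixes [F] pointwise. *)
Lemma expg_commute_kernel x f : F f -> commute (x ^+ E)%g f.
Proof.
move=> Ff; apply/commute_sym/commgP; rewrite -conjg_fix; apply/eqP.
have -> : (f ^ (x ^+ E))%g = iter E (conjg^~ x) f.
  elim: (E) => [|n IH]; first by rewrite expg0 conjg1.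
  by rewrite expgSr conjgM IH.
apply: iter_fact_fix; first exact: conjg_inj.
  by move=> y; rewrite !mem_F !inE; exact: FJ.
by rewrite mem_F inE.
Qed.

Lemma expgM_mod_kernel x f n : H x -> F f ->
  exists2 f', F f' & ((x * f) ^+ n = x ^+ n * f')%g.
Proof.
move=> Hx Ff; elim: n => [|n [f' Ff' IH]]; first by exists 1%g; rewrite ?expg0 ?mulg1.
exists (f ^ (x ^+ n) * f')%g; first by apply: FM => //; exact: FJ.
by rewrite expgS IH expgS conjgE !mulgA mulgK.
Qed.

(** One factor [E] moves the discrepancy to the right, [(x f)^E = x^E f'] with [f'] in [F], and
    makes [x^E] commute with [f']; the second one kills [f']. *)
Lemma expg_factor x f : H x -> F f -> ((x * f) ^+ (E * E) = x ^+ (E * E))%g.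
Proof.
move=> Hx Ff; have [f' Ff' eq1] := expgM_mod_kernel E Hx Ff.
rewrite !expgnA eq1 expgMn ?(expg_kernel Ff') ?mulg1 //.
exact: expg_commute_kernel.
Qed.

(** Conjugation by [y] multiplies [x] by a commutator, which lies in [F] and is therefore invisible
    to the exponent [E * E]. *)
Lemma expg_central x y : H x -> H y -> commute (x ^+ (E * E))%g y.
Proof.
move=> Hx Hy; apply/commgP; rewrite -conjg_fix conjXg; apply/eqP.
have -> : (x ^ y = x * [~ x, y])%g by rewrite /commg mulVKg.
by apply: expg_factor => //; exact: FR.
Qed.

Lemma expgM_kernel x y n : H x -> H y ->
  exists2 f, F f & ((x * y) ^+ n = x ^+ n * y ^+ n * f)%g.
Proof.
move=> Hx Hy; elim: n => [|n [f Ff IH]]; first by exists 1%g; rewrite ?expg0 ?mulg1.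
exists ([~ y, x ^+ n] ^ (y ^+ n) * f)%g.
  by apply: FM => //; apply/FJ/FR => //; exact: HX.
rewrite expgS IH (expgS x) (expgS y); set r := [~ y, x ^+ n]%g.
have -> : (x * y * (x ^+ n * y ^+ n * f) = x * (y * x ^+ n) * y ^+ n * f)%g by rewrite !mulgA.
rewrite (commgC y (x ^+ n)%g) -/r.
have -> : (x * (x ^+ n * y * r) * y ^+ n * f = x * x ^+ n * y * (r * y ^+ n) * f)%g by rewrite !mulgA.
by rewrite (conjgC r) !mulgA.
Qed.

(** Two factors make powers independent of the class modulo [F] and central in [H]; the third kills
    the element of [F] by which the power of a product differs from the product of the powers. *)
Definition kernel_exponent := (E * E * E)%N.

Lemma kernel_exponent_gt0 : (0 < kernel_exponent)%N.
Proof. by rewrite !muln_gt0 !fact_gt0. Qed.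

Lemma expg_exponent_factor x f : H x -> F f ->
  ((x * f) ^+ kernel_exponent = x ^+ kernel_exponent)%g.
Proof. by move=> Hx Ff; rewrite /kernel_exponent !(expgnA _ (E * E)%N) expg_factor. Qed.

Lemma expg_exponentM x y : H x -> H y ->
  ((x * y) ^+ kernel_exponent = x ^+ kernel_exponent * y ^+ kernel_exponent)%g.
Proof.
move=> Hx Hy; have [f Ff eq1] := expgM_kernel (E * E) Hx Hy.
rewrite /kernel_exponent !(expgnA _ (E * E)%N) eq1 expgMn.
  by rewrite (expg_kernel Ff) mulg1 expgMn //; apply: expg_central => //; exact: HX.
apply: commute_sym; apply: commuteM; apply: commute_sym; apply: expg_central => //; exact: FH.
Qed.

End PowerMap.

(** * Norms and discrete groups of isometries *)

Section Norms.
Context {R : realType} {d : nat}.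
Implicit Types (x y : 'cV[R]_d) (g h : euclid R d).

Lemma fnorm_ge0 m n (A : 'M[R]_(m, n)) : 0 <= fnorm A.
Proof. exact: sqrtr_ge0. Qed.

Lemma sqr_fnorm x : fnorm x ^+ 2 = \sum_i x i 0 ^+ 2.
Proof.
rewrite sqr_sqrtr; last by do 2!apply: sumr_ge0 => ? _; exact: sqr_ge0.
by apply: eq_bigr => i _; rewrite big_ord1.
Qed.

Lemma sqr_fnorm_dot x : fnorm x ^+ 2 = (x^T *m x) 0 0.
Proof. by rewrite sqr_fnorm mxE; apply: eq_bigr => i _; rewrite mxE. Qed.

Lemma fnorm_lin g x : fnorm (lin g *m x) = fnorm x.
Proof.
apply/eqP; rewrite -(@eqrXn2 _ 2) ?fnorm_ge0// !sqr_fnorm_dot.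
by rewrite trmx_mul mulmxA -(mulmxA x^T) linP mulmx1.
Qed.

Lemma entry_le_fnorm x i : `|x i 0| <= fnorm x.
Proof.
rewrite -(@ler_pXn2r _ 2) ?nnegrE ?fnorm_ge0// sqr_fnorm real_normK ?num_real//.
by rewrite (bigD1 i)//= lerDl sumr_ge0// => j _; exact: sqr_ge0.
Qed.

Lemma mx_norm_leP x (M : R) : 0 <= M ->
  reflect (forall i, `|x i 0| <= M) (`|x| <= M).
Proof.
move=> M0; rewrite [leLHS]/Num.Def.normr /= mx_normrE; apply: (iffP (bigmax_leP _ _ _ _)).
  by case=> _ H i; exact: (H (i, 0)).
by move=> H; split => // -[i j] _ /=; rewrite ord1.
Qed.

Lemma entry_le_norm x i : `|x i 0| <= `|x|.
Proof. by move: i; apply/mx_norm_leP. Qed.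

Lemma norm_le_fnorm x : `|x| <= fnorm x.
Proof. by apply/mx_norm_leP; [exact: fnorm_ge0|exact: entry_le_fnorm]. Qed.

Lemma fnorm_le_norm x : fnorm x <= d%:R * `|x|.
Proof.
rewrite -(@ler_pXn2r _ 2) ?nnegrE ?fnorm_ge0 ?mulr_ge0// sqr_fnorm exprMn.
have -> : (d%:R ^+ 2 * `|x| ^+ 2 : R) = \sum_(i < d) (d%:R * `|x| ^+ 2).
  by rewrite sumr_const card_ord expr2 -mulrA mulr_natl.
apply: ler_sum => i _; apply: (@le_trans _ _ (`|x| ^+ 2)).
  rewrite -(real_normK (num_real (x i 0))) ler_pXn2r ?nnegrE//.
  exact: entry_le_norm.
by rewrite ler_peMl ?sqr_ge0// ler1n; case: d x i => // x [].
Qed.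

Lemma norm_lin g x : `|lin g *m x| <= d%:R * `|x|.
Proof.
by apply: le_trans (norm_le_fnorm _) _; rewrite fnorm_lin; exact: fnorm_le_norm.
Qed.

Lemma lin_mul g h : lin (g * h)%g = lin g *m lin h. Proof. by []. Qed.
Lemma trans_mul g h : trans (g * h)%g = trans g + lin g *m trans h. Proof. by []. Qed.
Lemma lin_one : lin (1%g : euclid R d) = 1%:M. Proof. by []. Qed.
Lemma trans_one : trans (1%g : euclid R d) = 0. Proof. by []. Qed.
Lemma lin_inv g : lin g^-1%g = (lin g)^T. Proof. by []. Qed.
Lemma linPV g : lin g *m (lin g)^T = 1%:M. Proof. exact/mulmx1C/linP. Qed.

Lemma act_mul g h x : act (g * h)%g x = act g (act h x).
Proof. by rewrite /act lin_mul trans_mul mulmxDr mulmxA -addrA (addrC (trans g)). Qed.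

Lemma act_one x : act 1%g x = x.
Proof. by rewrite /act lin_one trans_one mul1mx addr0. Qed.

Lemma actB g x y : act g x - act g y = lin g *m (x - y).
Proof. by rewrite /act mulmxBr opprD addrACA subrr addr0. Qed.

End Norms.

Section Discrete.
Context {R : realType} {d : nat} {G : groupClosed (euclid R d)}.
Hypothesis hG : discrete_group G.

(** Discreteness isolates [x] in its orbit; the isometry [h^-1] carries the point [h . x] back to
    [x], so one radius serves the whole orbit. *)
Lemma orbit_gap (x : 'cV[R]_d) : exists2 e : R, 0 < e &
  forall g h : carrier G, (forall i, `|(act (val g) x - act (val h) x) i 0| < e) ->
    act (val g) x = act (val h) x.
Proof.
have Ox : [set act g x | g in [set` G]] x.
  by exists 1%g; [exact: gpred1|exact: act_one].
have [_ [U nU UO]] := hG Ox.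
have [e /= e0 eU] := (nbhs_ballP _ _).1 nU.
(* The Euclidean norm is at most [d] times the largest entry; the divisor [d.+1] keeps the estimate
   strict and covers [d = 0]. *)
exists (e / d.+1%:R); first exact: divr_gt0.
move=> g h gh; suff : (act (val h^-1 * val g)%g x) = x.
  move=> /(congr1 (act (val h))); rewrite -act_mul mulgA.
  by rewrite [(val h * _)%g]mulgV mul1g.
suff : (U `&` [set act g x | g in [set` G]]) (act (val h^-1 * val g)%g x).
  by rewrite UO.
split; last by exists (val (h^-1 * g)%g) => //; exact: (valP (h^-1 * g)%g).
apply: eU; rewrite mx_norm_ball /ball_ /= distrC.
apply: le_lt_trans (norm_le_fnorm _) _.
have -> : act (val h^-1 * val g)%g x - x = lin (val h^-1%g) *m (act (val g) x - act (val h) x).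
  rewrite -actB -!act_mul -[in X in _ - X](act_one x); congr (_ - act _ _).
  by rewrite [(_ * val h)%g]mulVg.
rewrite fnorm_lin; apply: le_lt_trans (fnorm_le_norm _) _.
have : `|act (val g) x - act (val h) x| <= e / d.+1%:R.
  by apply/mx_norm_leP => [|i]; [rewrite divr_ge0// ltW|exact/ltW].
move=> /(ler_wpM2l (ler0n _ d)) /le_lt_trans; apply.
by rewrite mulrA ltr_pdivrMr// mulrC ltr_pM2l// ltr_nat.
Qed.

Lemma finite_set_inj (A B : choiceType) (D : set A) (f : A -> B) :
  {in D &, injective f} -> finite_set (f @` D) -> finite_set D.
Proof. by move=> /inj_card_eq/eq_finite_set ->. Qed.

(* Pigeonhole on the integer parts of the numbers [f j x / e]. *)
Lemma finite_separated (A : choiceType) (J : finType) (D : set A) (f : J -> A -> R)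
    (r e : R) : 0 < e -> (forall j x, D x -> `|f j x| <= r) ->
  (forall x y, D x -> D y -> (forall j, `|f j x - f j y| < e) -> x = y) ->
  finite_set D.
Proof.
move=> e0 fr fsep; pose key x := [ffun j => Num.floor (f j x / e)].
apply: (@finite_set_inj _ _ _ key).
  move=> x y; rewrite !inE => Dx Dy exy; apply: fsep => // j.
  have := congr1 (fun k : {ffun J -> int} => k j) exy; rewrite !ffunE => eqf.
  have := floor_itv (f j x / e); have := floor_itv (f j y / e); rewrite -eqf.
  set m := Num.floor _ => /andP[h1 h2] /andP[h3 h4].
  have : `|f j x / e - f j y / e| < 1.
    by rewrite ltr_norml intrD1 in h2 h4 *; apply/andP; split; lra.
  by rewrite -mulrBl normrM (gtr0_norm (x := e^-1)) ?invr_gt0// ltr_pdivrMr// mul1r.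
pose K := (Num.bound (r / e)).+2.
pose of_key (k : {ffun J -> 'I_(K + K)}) : {ffun J -> int} :=
  [ffun j => (k j)%:Z - K%:Z].
apply: (@sub_finite_set _ _ (of_key @` setT)); last exact/finite_image/finite_finset.
move=> _ [x Dx <-].
have bnd j : `|Num.floor (f j x / e)| < K%:Z.
  have fb : `|f j x / e| < (Num.bound (r / e))%:R.
    apply: le_lt_trans (archi_boundP _); last first.
      by apply: divr_ge0 (ltW e0); exact: le_trans (fr j x Dx).
    by rewrite normrM (gtr0_norm (x := e^-1)) ?invr_gt0// ler_pM2r ?invr_gt0// fr.
  have /andP[h1 h2] := floor_itv (f j x / e); move: fb; rewrite ltr_norml => /andP[h3 h4].
  rewrite -(ltr_int R) -pmulrn intr_norm ltr_norml /K -addn2 natrD.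
  by rewrite intrD1 in h2; apply/andP; split; lra.
have lt_key j : (absz (Num.floor (f j x / e) + K%:Z)%R < K + K)%N by have := bnd j; lia.
exists [ffun j => Ordinal (lt_key j)] => //.
apply/ffunP => j; rewrite !ffunE /=; have := bnd j; lia.
Qed.

(** An affine map is determined by its values at the origin and the unit vectors, the points [pt]. A
    bound on the translation bounds these values, and [orbit_gap] separates them. *)
Lemma finite_bounded_trans (r : R) :
  finite_set [set g : carrier G | `|trans (val g)| <= r].
Proof.
pose pt (k : 'I_d.+1) : 'cV[R]_d := if unlift ord0 k is Some i then delta_mx i 0 else 0.
have /choice[e eP] : forall k, exists e : R, 0 < e /\
    forall g h : carrier G, (forall i, `|(act (val g) (pt k) - act (val h) (pt k)) i 0| < e) ->
    act (val g) (pt k) = act (val h) (pt k).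
  by move=> k; have [e e0 eP] := orbit_gap (pt k); exists e; split.
pose e0 := \big[Num.min/1]_k e k.
pose f (j : 'I_d.+1 * 'I_d) (g : carrier G) := act (val g) (pt j.1) j.2 0.
have e0_gt0 : 0 < e0 by apply/bigmin_gtP; split => // k _; case: (eP k).
apply: (@finite_separated _ _ _ f (d%:R + r) e0) => //.
  move=> [k i] g /= gr; rewrite /f /act /= mxE; apply: le_trans (ler_normD _ _) _.
  apply: lerD; last exact: le_trans (entry_le_norm _ _) gr.
  apply: le_trans (entry_le_norm _ _) _; apply: le_trans (norm_lin _ _) _.
  rewrite ler_piMr//; apply/mx_norm_leP => // j.
  by rewrite /pt; case: unliftP => [k' _|_]; rewrite !mxE ?normr0// eqxx andbT normr_nat; case: eqP.
move=> g h gr hr gh.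
have pgh k : act (val g) (pt k) = act (val h) (pt k).
  apply: (eP k).2 => i; have := gh (k, i); rewrite /f /= !mxE => /lt_le_trans; apply.
  exact: bigmin_le.
have tgh : trans (val g) = trans (val h).
  by have := pgh ord0; rewrite /pt unlift_none /act !mulmx0 !add0r.
apply: val_inj; apply: euclidP => //; apply/matrixP => i j.
have := pgh (lift ord0 j); rewrite /pt liftK /act tgh => /addIr /matrixP/(_ i 0).
by rewrite -!colE !mxE.
Qed.

Lemma finite_stab (x : 'cV[R]_d) : finite_set (stab (G := G) x).
Proof.
apply: (@sub_finite_set _ _ _ _ (finite_bounded_trans (`|x| + d%:R * `|x|))) => g /= gx.
have -> : trans (val g) = x - lin (val g) *m x by rewrite -[in X in X - _]gx /act addrC addKr.
by apply: le_trans (ler_normB _ _) _; rewrite lerD2l norm_lin.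
Qed.

End Discrete.

(** * Groups in normal form and the subgroups [T^N] *)

Section NormalFormTheory.
Context {R : realType} {d1 d2 : nat}.
Context {G : groupClosed (euclid R (d1 + d2))} {S : groupClosed (euclid R d2)}.
Implicit Types (g h x : carrier G) (s : euclid R d2).

(** The projection [pi] as a total function: in a group in normal form the relation has exactly one
    value at each element. *)
Definition space_part g : euclid R d2 := xget 1%g [set s | osum_proj (val g) s].
Local Notation pr := space_part.

Lemma osum_proj_inj (g : euclid R (d1 + d2)) s s' :
  osum_proj g s -> osum_proj g s' -> s = s'.
Proof.
move=> [A _ [l t]] [A' _ [l' t']]; apply: euclidP.
  by have := congr1 drsubmx l'; rewrite l !block_mxKdr.
by have := congr1 dsubmx t'; rewrite t !col_mxKd.
Qed.

Lemma osum_projM (g h : euclid R (d1 + d2)) s s' :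
  osum_proj g s -> osum_proj h s' -> osum_proj (g * h)%g (s * s')%g.
Proof.
move=> [A oA [l t]] [A' oA' [l' t']]; exists (A *m A').
  rewrite /orthogonal_mx trmx_mul mulmxA -(mulmxA _ _ A).
  by rewrite (eqP oA) mulmx1.
split; first by rewrite lin_mul l l' mulmx_block !(mul0mx, mulmx0, addr0, add0r).
rewrite trans_mul t t' l mul_block_col !(mul0mx, mulmx0, addr0, add0r).
by rewrite add_col_mx addr0.
Qed.

Hypothesis hGS : normal_form G S.
Let hS : discrete_group S. Proof. by case: hGS => -[]. Qed.
Let hG : discrete_group G. Proof. by case: hGS. Qed.

Lemma space_partP g : pr g \in S /\ osum_proj (val g) (pr g).
Proof.
case: hGS => _ _ /(_ (val g) (valP g)) [s Ss gs] _.
have gpr : osum_proj (val g) (pr g) by apply: xgetPex; exists s.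
by rewrite (osum_proj_inj gpr gs).
Qed.

Lemma space_partE g s : osum_proj (val g) s -> pr g = s.
Proof. exact/osum_proj_inj/(space_partP g).2. Qed.

Lemma space_partM g h : pr (g * h)%g = (pr g * pr h)%g.
Proof.
by apply: space_partE; apply: osum_projM; [case: (space_partP g)|case: (space_partP h)].
Qed.

Lemma space_part1 : pr 1%g = 1%g.
Proof. by apply: (@mulIg _ (pr 1%g)); rewrite -space_partM !mul1g. Qed.

Lemma space_partV g : pr g^-1%g = (pr g)^-1%g.
Proof. by apply: (@mulIg _ (pr g)); rewrite -space_partM !mulVg space_part1. Qed.

Lemma space_partX g n : pr (g ^+ n)%g = (pr g ^+ n)%g.
Proof. by elim: n => [|n IH]; rewrite ?expg0 ?space_part1// !expgS space_partM IH. Qed.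

Lemma space_partJ g h : pr (g ^ h)%g = (pr g ^ pr h)%g.
Proof. by rewrite !conjgE !space_partM space_partV. Qed.

Lemma trans_space_part g : trans (val g) = col_mx 0 (trans (pr g)).
Proof. by case: (space_partP g) => _ [A _ []]. Qed.

Lemma norm_trans_space_part g : `|trans (val g)| <= `|trans (pr g)|.
Proof.
rewrite trans_space_part; apply/mx_norm_leP => // i; rewrite mxE.
by case: splitP => j _; rewrite ?mxE ?normr0//; exact: entry_le_norm.
Qed.

Lemma translationM s s' : is_translation s -> is_translation s' -> is_translation (s * s')%g.
Proof. by rewrite /is_translation /= lin_mul => -> ->; rewrite mulmx1. Qed.

Lemma translationV s : is_translation s -> is_translation s^-1%g.
Proof. by rewrite /is_translation /= lin_inv => ->; rewrite trmx1. Qed.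

Lemma translationJ s s' : is_translation s' -> is_translation (s' ^ s)%g.
Proof.
by rewrite /is_translation /= conjgE !lin_mul lin_inv => ->; rewrite mul1mx linP.
Qed.

Lemma trans_translationM s s' : is_translation s ->
  trans (s * s')%g = trans s + trans s'.
Proof. by rewrite trans_mul => ->; rewrite mul1mx. Qed.

Lemma translation_eq s s' : is_translation s -> is_translation s' ->
  trans s = trans s' -> s = s'.
Proof. by move=> h h' e; apply: euclidP => //; rewrite h h'. Qed.

Lemma translationC s s' : is_translation s -> is_translation s' -> commute s s'.
Proof.
move=> h h'; apply: translation_eq; [exact: translationM|exact: translationM|].
by rewrite !trans_translationM// addrC.
Qed.

Lemma translationX s n : is_translation s -> is_translation (s ^+ n)%g.
Proof.
move=> h; elim: n => [|n IH]; first by rewrite expg0.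
by rewrite expgS; exact: translationM.
Qed.

Lemma trans_translationX s n : is_translation s -> trans (s ^+ n)%g = n%:R *: trans s.
Proof.
move=> h; elim: n => [|n IH]; first by rewrite expg0 scale0r trans_one.
by rewrite expgS trans_translationM// IH -natr1 scalerDl scale1r addrC.
Qed.

(** The extension fed to the power map: [H] modulo the kernel [F] is abelian because translations
    commute. *)
Let H := [set g : carrier G | is_translation (pr g)].
Let F := [set g : carrier G | pr g = 1%g].

Let Ffin : finite_set F.
Proof.
apply: (@sub_finite_set _ _ _ _ (finite_bounded_trans hG 0)) => g /= g1.
by apply: le_trans (norm_trans_space_part _) _; rewrite g1 trans_one normr0.
Qed.

Let e := kernel_exponent F.

Let expM x y : H x -> H y -> ((x * y) ^+ e = x ^+ e * y ^+ e)%g.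
Proof.
apply: expg_exponentM => //; rewrite /H /F /= ?space_part1//.
- by move=> {x y} x y; rewrite space_partM; exact: translationM.
- by move=> {x y} x y; rewrite space_partM => -> ->; rewrite mul1g.
- by move=> ? /= ->.
- by move=> z f; rewrite /conjg !space_partM space_partV => ->; rewrite mul1g mulVg.
- move=> {x y} x y hx hy; rewrite /commg /conjg !space_partM !space_partV.
  by rewrite (translationC hx hy) !mulgA mulgVK mulVg.
Qed.

Let exp_factor x f : H x -> F f -> ((x * f) ^+ e = x ^+ e)%g.
Proof.
apply: (expg_exponent_factor (H := H)) => //; rewrite /H /F /= ?space_part1//.
- by move=> {x} x y; rewrite space_partM => -> ->; rewrite mul1g.
- by move=> z g; rewrite /conjg !space_partM space_partV => ->; rewrite mul1g mulVg.
Qed.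

Context {T : set (carrier G)}.
Hypothesis hT : translation_lift S T.

Lemma lift_translation t : T t -> is_translation (pr t).
Proof. by case: hT => + _ => /[apply] -[s [_ hs /space_partE ->]]. Qed.

Lemma lift_ex s : s \in S -> is_translation s -> exists2 t, T t & pr t = s.
Proof.
case: hT => _ /[apply] /[apply] -[t [[Tt /space_partE ts] _]].
by exists t.
Qed.

Lemma lift_inj t t' : T t -> T t' -> pr t = pr t' -> t = t'.
Proof.
move=> Tt Tt' e1; case: hT => _ /(_ (pr t)) ex.
have [|t0 [_ U]] := ex _ (lift_translation Tt); first by case: (space_partP t).
have <- : t0 = t by apply: U; split => //; exact: (space_partP t).2.
by apply: U; split => //; rewrite e1; exact: (space_partP t').2.
Qed.

(** The lift of [pr x] in [T] differs from [x] by an element of [F], which the exponent [e] erases.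
    Hence [powers T e] is the image of all of [H] under a homomorphism. *)
Let powers_exp x : H x -> powers T e (x ^+ e)%g.
Proof.
move=> hx; have [t Tt tx] := lift_ex (space_partP x).1 hx.
exists t => //; have -> : x = (t * (t^-1 * x))%g by rewrite mulVKg.
rewrite exp_factor//; first exact: lift_translation.
by rewrite /F /= space_partM space_partV tx mulVg.
Qed.

Lemma M0_ex : exists N, M0 T N.
Proof.
exists e; split; first exact: kernel_exponent_gt0.
have HT t : T t -> H t by exact: lift_translation.
split; first split.
- by have := @powers_exp 1%g; rewrite expg1n; apply; rewrite /H /= space_part1.
- move=> _ _ [t Tt <-] [t' Tt' <-]; rewrite -expM; [|exact: HT..].
  by apply: powers_exp; rewrite /H /= space_partM; apply: translationM; exact: HT.
- move=> _ [t Tt <-]; rewrite -expVgn; apply: powers_exp.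
  by rewrite /H /= space_partV; apply: translationV; exact: HT.
- move=> g _ [t Tt <-]; have := conjXg t g^-1%g e; rewrite conjgE invgK mulgA => ->.
  by apply: powers_exp; rewrite /H /= space_partJ; apply: translationJ; exact: HT.
Qed.

Section Fixed.
Variable N : nat.
Hypothesis hN : M0 T N.

Lemma powers_translation x : powers T N x -> is_translation (pr x).
Proof. by move=> [t Tt <-]; rewrite space_partX; exact/translationX/lift_translation. Qed.

Lemma powers_inj x y : powers T N x -> powers T N y ->
  trans (pr x) = trans (pr y) -> x = y.
Proof.
move=> [t Tt <-] [t' Tt' <-]; have [ht ht'] := (lift_translation Tt, lift_translation Tt').
rewrite !space_partX !trans_translationX// => /scalerI e1; congr (_ ^+ _)%g.
apply: lift_inj => //; apply: translation_eq => //; apply: e1.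
by rewrite pnatr_eq0 -lt0n; case: hN.
Qed.

(** A priori the elements commute only modulo [F]; but both products lie in the subgroup [T^N],
    where the translation vector determines the element. *)
Lemma powers_commute x y : powers T N x -> powers T N y -> commute x y.
Proof.
case: hN => _ [[_ PM _] _] Px Py; apply: powers_inj; [exact: PM..|].
have [hx hy] := (powers_translation Px, powers_translation Py).
by rewrite !space_partM !trans_translationM// addrC.
Qed.

Lemma powers_mulnE k x : powers T (N * k) x <-> exists2 y, powers T N y & x = (y ^+ k)%g.
Proof.
split=> [[t Tt <-]|[_ [t Tt <-] ->]]; last by exists t => //; rewrite expgnA.
by exists (t ^+ N)%g; [exists t|rewrite expgnA].
Qed.

(** The [k]-th powers of the abelian group [T^N] form a subgroup, and conjugation respects
    powers. *)
Lemma M0_mul k : (0 < k)%N -> M0 T (N * k).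
Proof.
case: (hN) => N0 [[P1 PM PV] PJ] k0; split; first by rewrite muln_gt0 N0.
split; first split.
- by apply/powers_mulnE; exists 1%g => //; rewrite expg1n.
- move=> x y /powers_mulnE[x' Px ->] /powers_mulnE[y' Py ->].
  apply/powers_mulnE; exists (x' * y')%g; first exact: PM.
  by rewrite expgMn//; exact: powers_commute.
- move=> x /powers_mulnE[x' Px ->]; apply/powers_mulnE; exists x'^-1%g; first exact: PV.
  by rewrite expVgn.
- move=> g x /powers_mulnE[x' Px ->]; apply/powers_mulnE.
  exists (g * x' * g^-1)%g; first exact: PJ.
  by have := conjXg x' g^-1%g k; rewrite !conjgE invgK !mulgA.
Qed.

Lemma powers_mul_sub k : powers T (N * k) `<=` powers T N.
Proof.
case: (hN) => _ [[P1 PM _] _] x /powers_mulnE[y Py ->].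
by elim: k => [|k IH]; rewrite ?expg0// expgS; exact: PM.
Qed.

Let lattice_ex (B : 'M[R]_d2) (m : 'rV[int]_d2) :
  (forall i, exists s, [/\ s \in S, is_translation s & trans s = (row i B)^T]) ->
  exists s, [/\ s \in S, is_translation s & trans s = (map_mx intr m *m B)^T].
Proof.
move=> hB.
pose L := [set v : 'cV[R]_d2 | exists s, [/\ s \in S, is_translation s & trans s = v]].
have L0 : L 0 by exists 1%g; split; [exact: gpred1|exact: lin_one|exact: trans_one].
have LD u v : L u -> L v -> L (u + v).
  move=> [s [Ss hs <-]] [s' [Ss' hs' <-]]; exists (s * s')%g.
  by split; [exact: gpredM|exact: translationM|exact: trans_translationM].
have LN u : L u -> L (- u).
  move=> [s [Ss hs <-]]; exists s^-1%g; split; [by rewrite gpredV|exact: translationV|].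
  by apply/eqP; rewrite -addr_eq0 -trans_translationM ?mulVg ?trans_one//; exact: translationV.
have Ln u n : L u -> L (u *+ n).
  by move=> Lu; elim: n => [|n IH]; rewrite ?mulr0n// mulrS; exact: LD.
have -> : (map_mx intr m *m B)^T = \sum_i (row i B)^T *~ m 0 i.
  apply/colP => j; rewrite !mxE summxE; apply: eq_bigr => i _.
  by rewrite -scaler_int !mxE.
rewrite -/(L _); elim/big_rec: _ => // i v _ Lv; apply: LD => //.
by case: (m 0 i) => n; rewrite ?NegzE ?mulrNz; [exact/Ln/hB|exact/LN/Ln/hB].
Qed.

(** Right multiplication by an element of [T^N] adds [L(g)] applied to [N] times a lattice vector.
    So the coordinates of [L(g)^T tau(g)] in the basis [B] can be reduced to the interval from [0]
    to [N]. *)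
Lemma bounded_representative : exists r : R, forall g,
  exists2 x, powers T N x & `|trans (val (g * x)%g)| <= r.
Proof.
case: (hGS) => -[_ [B fB hB]] _ _ _.
have N0 : 0 < N%:R :> R by rewrite ltr0n; case: hN.
pose r : R := \sum_j \sum_i N%:R * `|B i j|.
exists (d2%:R * r) => g; pose v := (lin (pr g))^T *m trans (pr g).
have [c vc] : exists c, v = (c *m B)^T.
  by exists (v^T *m invmx B); rewrite mulmxKV ?trmxK// -row_free_unit.
pose m : 'rV[int]_d2 := \row_i (- Num.floor (c 0 i / N%:R)).
have [s [Ss hs sm]] := lattice_ex m hB.
have [t Tt ts] := lift_ex Ss hs.
exists (t ^+ N)%g; first by exists t.
apply: le_trans (norm_trans_space_part _) _.
rewrite space_partM trans_mul space_partX ts trans_translationX//.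
have -> : trans (pr g) = lin (pr g) *m v by rewrite mulmxA linPV mul1mx.
rewrite -mulmxDr; apply: le_trans (norm_lin _ _) _; rewrite ler_wpM2l//.
have ge0 i j : 0 <= N%:R * `|B i j| by rewrite mulr_ge0// ltW.
apply/mx_norm_leP => [|j]; first by apply: sumr_ge0 => j _; apply: sumr_ge0.
apply: (@le_trans _ _ (\sum_i N%:R * `|B i j|)); last first.
  by rewrite /r [leRHS](bigD1 j)//= lerDl; apply: sumr_ge0 => k _; apply: sumr_ge0.
have -> : v + N%:R *: trans s = ((c + N%:R *: map_mx intr m) *m B)^T.
  by rewrite sm vc mulmxDl -scalemxAl linearD linearZ.
rewrite !mxE; apply: le_trans (ler_norm_sum _ _ _) _; apply: ler_sum => i _.
rewrite normrM ler_wpM2r// /m !mxE rmorphN /=.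
have /andP[h1 h2] := floor_itv (c 0 i / N%:R).
rewrite -[c 0 i](@divfK _ N%:R) ?gt_eqF// mulfK ?gt_eqF//.
move: (c 0 i / _) (Num.floor _) h1 h2 => a n h1 h2.
have -> : a * N%:R + N%:R * - n%:~R = (a - n%:~R) * N%:R by ring.
rewrite normrM ger0_norm; last by lra.
rewrite ger0_norm ?ler0n// ler_piMl ?ler0n//; rewrite intrD1 in h2; lra.
Qed.

(** Moving each representative inside its coset to a bounded translation is injective on [C], and
    its image is finite. *)
Lemma finite_representatives C : representatives (powers T N) C -> finite_set C.
Proof.
case: (hN) => _ [[P1 PM PV] _] hC; have [r rP] := bounded_representative.
have /choice[f fP] : forall g, exists x, powers T N x /\ `|trans (val (g * x)%g)| <= r.
  by move=> g; have [x] := rP g; exists x.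
apply: (@finite_set_inj _ _ _ (fun g => g * f g)%g); last first.
  apply: sub_finite_set (finite_bounded_trans hG r) => _ [g _ <-].
  exact: (fP g).2.
move=> c c'; rewrite !inE => Cc Cc' ecc.
have [c0 [_ U]] := hC c; have <- : c0 = c by apply: U; split => //; exists 1%g => //; rewrite mulg1.
apply: U; split => //; exists (f c * (f c')^-1)%g; last by rewrite mulgA ecc mulgK.
by apply: PM; [exact: (fP c).1|apply/PV; exact: (fP c').1].
Qed.

End Fixed.

(** On the preimage of the translations the last [d2] coordinates of every point move by the same
    vector; thus translation lengths can be read off from the motion of [x0]. *)
Lemma dsubmx_act (x0 : 'cV[R]_(d1 + d2)) x : is_translation (pr x) ->
  dsubmx (act (val x) x0 - x0) = trans (pr x).
Proof.
case: (space_partP x) => _ [A _ [lA tA]] lp.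
rewrite /act lA tA lp -[x0 in LHS]vsubmxK mul_block_col !(mul0mx,mul1mx,add0r).
by rewrite add_col_mx opp_col_mx add_col_mx col_mxKd addrAC subrr add0r.
Qed.

Lemma powers_stab N (x0 : 'cV[R]_(d1 + d2)) x : M0 T N -> powers T N x ->
  stab x0 x -> x = 1%g.
Proof.
move=> hN Px hx; apply: (powers_inj hN) => //; first by case: hN => _ [[]].
rewrite space_part1 -(dsubmx_act x0); last exact: powers_translation Px.
by rewrite (hx : act _ _ = _) subrr; apply/matrixP => i j; rewrite !mxE.
Qed.

(* Elements of [T^N] translate by at least [N] times the minimal lattice length. *)
Lemma M0_avoid (x0 : 'cV[R]_(d1 + d2)) g : act (val g) x0 <> x0 ->
  exists2 N, M0 T N & forall h, stab x0 h -> ~ powers T N (g * h)%g.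
Proof.
move=> gx0; have [e1 e1_gt0 gap] := orbit_gap hS 0.
have [N0 hN0] := M0_ex.
pose l := `|act (val g) x0 - x0|.
(* With this [k] a nonzero translation raised to the power [M] exceeds [d2 * l], whereas [g * h]
   moves [x0] only by [l]. *)
pose k := (Num.bound (d2%:R * l / e1)).+1.
pose M := (N0 * k)%N; have hM : M0 T M by exact: M0_mul.
exists M => // h hx [t Tt tg].
have ht := lift_translation Tt.
(* A zero translation forces [g * h = 1], and then [g] fixes [x0] because [h] does. *)
have [t0|t0] := eqVneq (trans (pr t)) 0.
  have pt1 : pr t = 1%g by apply: translation_eq => //; exact: lin_one.
  have gh1 : (g * h)%g = 1%g.
    apply: (powers_inj hM); [by exists t|by case: hM => _ [[]]|].
    by rewrite -tg space_partX pt1 expg1n space_part1.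
  apply: gx0; rewrite -{1}hx -act_mul.
  by have := congr1 val gh1; rewrite valM => ->; exact: act_one.
have St : pr t \in S by case: (space_partP t).
have [i] : exists i, e1 <= `|trans (pr t) i 0|.
  apply/existsP; rewrite -[X in is_true X]negbK negb_exists; apply/negP => /forallP small.
  case/eqP: t0; have := gap (exist _ (pr t) St) 1%g.
  rewrite /= act_one /act mulmx0 add0r; apply => i.
  by rewrite subr0 ltNge.
apply/negP; rewrite -ltNge.
have : `|trans (pr (t ^+ M)%g) i 0| <= d2%:R * l; last first.
  rewrite space_partX trans_translationX// mxE normrM ger0_norm ?ler0n//.
  rewrite natrM -mulrA => le1.
  have N01 : 1 <= N0%:R :> R by rewrite ler1n; case: hN0.
  have lt2 : d2%:R * l / e1 < k%:R.
    apply: lt_le_trans (archi_boundP _) _; first by rewrite divr_ge0 ?mulr_ge0 ?normr_ge0 ?(ltW e1_gt0).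
    by rewrite ler_nat.
  rewrite ltNge; apply/negP => le3; move: lt2; rewrite ltr_pdivrMr// ltNge => /negP; apply.
  apply: le_trans le1; rewrite -[leLHS]mul1r ler_pM ?ler01 ?mulr_ge0 ?ler0n ?(ltW e1_gt0)//.
  by rewrite ler_wpM2l ?ler0n.
rewrite tg.
have e2 : act (val (g * h)%g) x0 - x0 = act (val g) x0 - x0 by rewrite valM act_mul hx.
have e3 : dsubmx (act (val (g * h)%g) x0 - x0) = trans (pr (g * h)%g).
  by rewrite dsubmx_act// -tg space_partX; exact: translationX.
rewrite -e3 e2 mxE; apply: le_trans (entry_le_norm _ _) _.
rewrite ler_peMl// ler1n; by case: (d2) i => // -[].
Qed.

End NormalFormTheory.

(** * Means over cosets *)

Section CosetMean.
Context {R : realType} {d : nat} {G : groupClosed (euclid R d)}.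
Implicit Types (H C : set (carrier G)) (F : carrier G -> R).

Definition coset_mean C F : R :=
  (#|` fset_set C|%:R)^-1 * \sum_(g \in C) F g.

Lemma card_fsbig (I : choiceType) (A : set I) : finite_set A ->
  (#|` fset_set A|%:R : R) = \sum_(g \in A) (1 : R).
Proof.
by move=> fA; rewrite fsbig_finite// big_const_seq count_predT iter_addr_0.
Qed.

(** The second transversal is given by an indexing map, so that the lemma applies both to products
    [c * k] of representatives and to right translates of [C]. *)
Lemma transversal_sum (P : choiceType) (A : set P) (phi : P -> carrier G) H C F :
  is_subgroup H -> representatives H C ->
  (forall g, exists! p, A p /\ exists2 h, H h & phi p = (g * h)%g) ->
  (forall g h, H h -> F (g * h)%g = F g) ->
  \sum_(p \in A) F (phi p) = \sum_(c \in C) F c.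
Proof.
move=> [H1 HM HV] hC hA hF.
have /choice[f fP] : forall g, exists p, unique (fun p => A p /\ exists2 h, H h & phi p = (g * h)%g) p.
  by move=> g; have [p pP] := hA g; exists p.
rewrite (reindex_fsbig f C A).
  apply: eq_fsbigr => c _; have [[_ [h Hh ->]] _] := fP c; exact: hF.
split.
- by move=> c _; have [[]] := fP c.
- move=> c c'; rewrite !inE => Cc Cc' ecc.
  have [[_ [h Hh e1]] _] := fP c; have [[_ [h' Hh' e2]] _] := fP c'.
  have [c0 [_ U]] := hC c.
  have <- : c0 = c by apply: U; split => //; exists 1%g => //; rewrite mulg1.
  apply: U; split => //; exists (h * h'^-1)%g; first by apply: HM => //; exact: HV.
  by rewrite mulgA -e1 ecc e2 mulgK.
- move=> p Ap; have [c [[Cc [h Hh ch]] _]] := hC (phi p).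
  exists c => //; have [_ U] := fP c; apply: U; split => //.
  by exists h^-1%g; [exact: HV|rewrite ch mulgK].
Qed.

(** The products of [C] with [K] represent the cosets of [H'], so the sum over [C'] is the size of
    [K] times the sum over [C]. The same identity for the constant [1] cancels that factor. *)
Lemma coset_mean_sub H H' C C' F : is_subgroup H -> is_subgroup H' -> H' `<=` H ->
  representatives H C -> representatives H' C' -> finite_set C -> finite_set C' ->
  (forall g h, H h -> F (g * h)%g = F g) ->
  coset_mean C F = coset_mean C' F.
Proof.
move=> sH sH' HH' hC hC' fC fC'; case: (sH) => H1 HM HV.
pose K := C' `&` H; have fK : finite_set K by exact: finite_setIl.
have key F' : (forall g h, H h -> F' (g * h)%g = F' g) ->
    \sum_(g \in C') F' g = (\sum_(k \in K) (1 : R)) * \sum_(c \in C) F' c.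
  move=> hF'; rewrite -(@transversal_sum _ (C `*` K) (fun p => p.1 * p.2)%g H')//.
  - rewrite mulrC mulr_fsuml.
    rewrite [RHS](_ : _ = \sum_(c \in C) \sum_(k \in K) F' c); last first.
      apply: eq_fsbigr => c _; rewrite mulr_fsumr.
      by apply: eq_fsbigr => k _; rewrite mulr1.
    rewrite pair_fsbig//; apply: eq_fsbigr => -[c k]; rewrite inE => -[/= _ [_ Hk]].
    by rewrite hF'.
  - move=> g; have [c [[Cc [h Hh ch]] Uc]] := hC g.
    have [k [[Ck [h' Hh' kh]] Uk]] := hC' (c^-1 * g)%g.
    have Hk : H k.
      rewrite kh ch invgM mulgVK.
      apply: HM; [exact: HV|exact: HH'].
    exists (c, k); split.
      by split => //=; exists h' => //; rewrite kh !mulgA mulgV mul1g.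
    move=> [c2 k2] [[/= Cc2 [Ck2 Hk2]] [h2 Hh2 e2]].
    have ec : c = c2.
      apply: Uc; split => //; exists (h2 * k2^-1)%g; last by rewrite mulgA -e2 mulgK.
      by apply: HM; [exact: HH'|exact: HV].
    congr (_, _) => //; apply: Uk; split => //; exists h2 => //.
    by rewrite -mulgA -e2 ec mulKg.
  - by move=> g h H'h; apply: hF'; exact: HH'.
move=> hF; rewrite /coset_mean !card_fsbig//.
rewrite !key// -[X in _ = _ * X](mulr1).
have neq0 : (\sum_(g \in C') (1 : R)) != 0.
  rewrite -card_fsbig// pnatr_eq0 cardfs_eq0.
  have [c [[Cc _] _]] := hC' 1%g.
  apply/eqP => e; have : c \in fset_set C' by rewrite in_fset_set// inE.
  by rewrite e in_fset0.
move: neq0; rewrite (key (fun=> 1))//.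
set k := \sum_(_ \in K) _; set s := \sum_(_ \in C) (1 : R); rewrite mulf_eq0 negb_or => /andP[k0 s0].
by field; rewrite k0 s0.
Qed.

(** Normality of [H] makes [C * k] a transversal again. *)
Lemma coset_mean_translate H C F k : normal_subgroup H -> representatives H C ->
  (forall g h, H h -> F (g * h)%g = F g) ->
  coset_mean C (fun g => F (g * k)%g) = coset_mean C F.
Proof.
move=> [sH HJ] hC hF; rewrite /coset_mean; congr (_ * _).
apply: (transversal_sum sH hC) => // g.
have [c [[Cc [h Hh ch]] U]] := hC (g * k^-1)%g; exists c; split.
  split => //; exists (k^-1 * h * k)%g; last by rewrite ch !mulgA.
  by have := HJ k^-1%g h Hh; rewrite invgK.
move=> c' [Cc' [h' Hh' e']]; apply: U; split => //; exists (k * h' * k^-1)%g; first exact: HJ.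
by rewrite !mulgA mulgVK -e' mulgK.
Qed.

Lemma coset_mean_fset C F : finite_set C ->
  coset_mean C F = (#|` fset_set C|%:R)^-1 * \sum_(g <- fset_set C) F g.
Proof. by move=> fC; rewrite /coset_mean fsbig_finite. Qed.

Lemma coset_mean_ge0 C F : finite_set C -> (forall g, 0 <= F g) -> 0 <= coset_mean C F.
Proof. by move=> fC F0; rewrite coset_mean_fset// mulr_ge0 ?invr_ge0// sumr_ge0. Qed.

Lemma eq_coset_mean C F F' : F =1 F' -> coset_mean C F = coset_mean C F'.
Proof. by move=> /funext ->. Qed.

Lemma ler_coset_mean C F F' : finite_set C -> (forall g, C g -> F g <= F' g) ->
  coset_mean C F <= coset_mean C F'.
Proof.
move=> fC FF'; rewrite !coset_mean_fset// ler_wpM2l ?invr_ge0//.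
by rewrite big_seq [leRHS]big_seq; apply: ler_sum => g; rewrite in_fset_set// inE; exact: FF'.
Qed.

Lemma coset_meanZ C F a : finite_set C ->
  coset_mean C (fun g => a * F g) = a * coset_mean C F.
Proof. by move=> fC; rewrite !coset_mean_fset// -mulr_sumr mulrCA. Qed.

Lemma coset_mean_sum C (I : Type) (s : seq I) (F : I -> carrier G -> R) : finite_set C ->
  coset_mean C (fun g => \sum_(i <- s) F i g) = \sum_(i <- s) coset_mean C (F i).
Proof.
move=> fC; rewrite coset_mean_fset// exchange_big mulr_sumr.
by apply: eq_bigr => i _; rewrite coset_mean_fset.
Qed.

Lemma coset_meanB C F F' : finite_set C ->
  coset_mean C F - coset_mean C F' = coset_mean C (fun g => F g - F' g).
Proof. by move=> fC; rewrite !coset_mean_fset// -mulrBr sumrB. Qed.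

Lemma coset_mean_norm C F : finite_set C -> `|coset_mean C F| <= coset_mean C (fun g => `|F g|).
Proof.
move=> fC; rewrite !coset_mean_fset// normrM ger0_norm ?invr_ge0// ler_wpM2l ?invr_ge0//.
exact: ler_norm_sum.
Qed.

Lemma coset_mean_cst C a H : finite_set C -> representatives H C ->
  coset_mean C (fun=> a) = a.
Proof.
move=> fC hC; rewrite coset_mean_fset// big_const_seq count_predT iter_addr_0.
have [c [[Cc _] _]] := hC 1%g.
rewrite -(mulr_natl a) mulKf// pnatr_eq0 cardfs_eq0.
apply/eqP => e; have : c \in fset_set C by rewrite in_fset_set// inE.
by rewrite e in_fset0.
Qed.

(** Lagrange's identity: the double sum of squares [D] is twice the difference of the two sides. *)
Lemma cauchy_schwarz_sum (I : Type) (s : seq I) (a b : I -> R) :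
  (\sum_(i <- s) a i * b i) ^+ 2 <= (\sum_(i <- s) a i ^+ 2) * (\sum_(i <- s) b i ^+ 2).
Proof.
pose D := \sum_(i <- s) \sum_(j <- s) (a i * b j - a j * b i) ^+ 2.
have D0 : 0 <= D by do 2!apply: sumr_ge0 => ? _; exact: sqr_ge0.
have e1 : (\sum_(i <- s) a i * b i) ^+ 2 = \sum_(i <- s) \sum_(j <- s) a i * b i * (a j * b j).
  by rewrite expr2 mulr_suml; apply: eq_bigr => i _; rewrite mulr_sumr.
have e2 : (\sum_(i <- s) a i ^+ 2) * (\sum_(i <- s) b i ^+ 2) =
    \sum_(i <- s) \sum_(j <- s) a i ^+ 2 * b j ^+ 2.
  by rewrite mulr_suml; apply: eq_bigr => i _; rewrite mulr_sumr.
have e3 : (\sum_(i <- s) a i ^+ 2) * (\sum_(i <- s) b i ^+ 2) =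
    \sum_(i <- s) \sum_(j <- s) a j ^+ 2 * b i ^+ 2 by rewrite e2 exchange_big.
set X := (\sum_(i <- s) a i * b i) ^+ 2 in e1 *.
set Y := (\sum_(i <- s) a i ^+ 2) * _ in e2 e3 *.
suff DE : D + X * 2 = Y + Y by move: D0; lra.
rewrite {1}e2 e3 e1 /D mulr_suml -!big_split; apply: eq_bigr => i _ /=.
by rewrite mulr_suml -!big_split; apply: eq_bigr => j _ /=; ring.
Qed.

Lemma coset_mean_cauchy_schwarz C F F' : finite_set C ->
  coset_mean C (fun g => F g * F' g) <=
  Num.sqrt (coset_mean C (fun g => F g ^+ 2)) * Num.sqrt (coset_mean C (fun g => F' g ^+ 2)).
Proof.
move=> fC; rewrite -sqrtrM; last by apply: coset_mean_ge0 => // g; exact: sqr_ge0.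
apply: le_trans (ler_norm _) _; rewrite -sqrtr_sqr; apply: ler_wsqrtr.
rewrite !coset_mean_fset// exprMn [leRHS]mulrACA -(expr2 _^-1) ler_wpM2l ?sqr_ge0//.
exact: cauchy_schwarz_sum.
Qed.

End CosetMean.

Section PeriodMean.
Context {R : realType} {d1 d2 : nat}.
Context {G : groupClosed (euclid R (d1 + d2))} {S : groupClosed (euclid R d2)}.
Context {T : set (carrier G)} {C : nat -> set (carrier G)}.
Hypothesis hGS : normal_form G S.
Hypothesis hT : translation_lift S T.
Hypothesis hC : forall N, M0 T N -> representatives (powers T N) (C N).
Implicit Types (u v : carrier G -> 'cV[R]_(d1 + d2)).

Lemma M0_subgroup N : M0 T N -> is_subgroup (powers T N).
Proof. by case=> _ []. Qed.

Lemma finite_C N : M0 T N -> finite_set (C N).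
Proof. by move=> hN; exact: (finite_representatives hGS hT hN (hC hN)). Qed.

Lemma coset_mean_mul N k F : M0 T N -> (0 < k)%N ->
  (forall g t, powers T N t -> F (g * t)%g = F g) ->
  coset_mean (C N) F = coset_mean (C (N * k)) F.
Proof.
move=> hN k0 hF; have hNk := M0_mul hGS hT hN k0.
apply: (@coset_mean_sub _ _ _ (powers T N) (powers T (N * k)%N)) => //;
  by [exact: M0_subgroup|exact: powers_mul_sub hN k|exact: hC|exact: finite_C].
Qed.

Lemma periodP u N : M0 T N -> periodic_wrt T N u ->
  M0 T (period T u) /\ periodic_wrt T (period T u) u.
Proof. by move=> hN pu; apply: (@xgetPex _ _ [set N | M0 T N /\ periodic_wrt T N u]); exists N. Qed.

(** [period T u] is an arbitrary choice among the periods, so [F] has to be invariant under each of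
    them; both means agree with the one for the common period [N * period T u]. *)
Lemma period_mean_eq u F N : M0 T N -> periodic_wrt T N u ->
  (forall N, M0 T N -> periodic_wrt T N u ->
    forall g t, powers T N t -> F (g * t)%g = F g) ->
  period_mean T C u F = coset_mean (C N) F.
Proof.
move=> hN pu hF; have [hN' pu'] := periodP hN pu.
rewrite /period_mean -/(coset_mean _ _).
rewrite (@coset_mean_mul _ N)//; [|by case: hN|exact: hF].
by rewrite [RHS](@coset_mean_mul _ (period T u))//; [rewrite mulnC|case: hN'|exact: hF].
Qed.

Lemma periodic_mul u N k : M0 T N -> periodic_wrt T N u -> periodic_wrt T (N * k) u.
Proof. by move=> hN pu g t /(powers_mul_sub hN); exact: pu. Qed.

(** Periodicity concerns factors on the right, so [t] is carried across [h] by normality. *)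
Lemma periodic_shift u N g t : M0 T N -> periodic_wrt T N u -> powers T N t ->
  (fun h => u (g * t * h)%g) = (fun h => u (g * h)%g).
Proof.
move=> [_ [_ NJ]] pu Pt; apply/funext => h.
have -> : (g * t * h = g * h * (h^-1 * t * h))%g by rewrite !mulgA mulgK.
by apply: pu; have := NJ h^-1%g t Pt; rewrite invgK.
Qed.

End PeriodMean.

(** * Orthogonal projections and local approximation *)

Section Projection.
Context {R : realType}.

Definition subspace {X : lmodType R} (U : set X) : Prop :=
  U 0 /\ forall (a : R) u v, U u -> U v -> U (a *: u + v).

Lemma subspaceB (X : lmodType R) (U : set X) u v :
  subspace U -> U u -> U v -> U (u - v).
Proof. by move=> [_ UD] Uu Uv; rewrite addrC -scaleN1r; exact: UD. Qed.

Lemma subspace_sum (X : lmodType R) (U : set X) (I : Type) (s : seq I) (a : I -> R) (f : I -> X) :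
  subspace U -> (forall i, U (f i)) -> U (\sum_(i <- s) a i *: f i).
Proof. by move=> [U0 UD] Uf; elim/big_rec: _ => // i x _; exact: UD. Qed.

Lemma row_dot_eq0 m (w : 'rV[R]_m) : (w *m w^T) 0 0 = 0 -> w = 0.
Proof.
rewrite mxE; under eq_bigr do rewrite mxE -expr2.
move=> /psumr_eq0P H; apply/rowP => i; rewrite mxE; apply/eqP.
by rewrite -sqrf_eq0 H// => j _; exact: sqr_ge0.
Qed.

Lemma row_dot_ge0 m (w : 'rV[R]_m) : 0 <= (w *m w^T) 0 0.
Proof. by rewrite mxE; apply: sumr_ge0 => i _; rewrite mxE -expr2 sqr_ge0. Qed.

(* [v *m Q^T *m Q] for an orthonormal family [Q] in [U] of maximal size. *)
Lemma row_projection m (U : set 'rV[R]_m) (v : 'rV[R]_m) : subspace U ->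
  exists2 u, U u & forall w, U w -> (v - u) *m w^T = 0.
Proof.
move=> sU; pose ok k := exists Q : 'M[R]_(k, m), Q *m Q^T = 1%:M /\ forall i, U (row i Q).
have ok_le k : ok k -> (k <= m)%N.
  move=> [Q [QQ _]]; rewrite -(mxrank1 R k) -QQ.
  exact: leq_trans (mxrankM_maxl _ _) (rank_leq_col _).
have ok0 : ok 0%N.
  by exists 0; split => [|[]//]; apply/matrixP => -[].
have exk : exists k, `[< ok k >] by exists 0%N; apply/asboolP.
have [k /asboolP[Q [QQ UQ]] kmax] := @ex_maxnP (fun k => `[< ok k >]) m exk (fun k h => ok_le k (asboolW h)).
have Uspan (a : 'rV_k) : U (a *m Q).
  by rewrite mulmx_sum_row; apply: subspace_sum.
have spanU w : U w -> w = w *m Q^T *m Q.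
  move=> Uw; apply/eqP; rewrite -subr_eq0; apply/negP => /negP w0.
  set w' := w - _ in w0.
  have Uw' : U w' by apply: subspaceB.
  have w'Q : w' *m Q^T = 0 by rewrite mulmxBl -!mulmxA QQ mulmx1 subrr.
  clearbody w'; pose s := (w' *m w'^T) 0 0.
  have s0 : 0 < s.
    by rewrite lt0r row_dot_ge0 andbT; apply: contra_neq w0; exact: row_dot_eq0.
  pose e := (Num.sqrt s)^-1 *: w'.
  have ee : e *m e^T = 1%:M.
    apply/matrixP => i j; rewrite !ord1 !mxE /=.
    have -> : \sum_j e 0 j * e^T j 0 = (Num.sqrt s)^-1 ^+ 2 * s.
      rewrite {2}/s mxE mulr_sumr; apply: eq_bigr => l _; rewrite /e; move: (Num.sqrt s) => r.
      by rewrite !mxE; ring.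
    by rewrite exprVn sqr_sqrtr ?ltW// mulVf// gt_eqF.
  have eQ : e *m Q^T = 0 by rewrite -scalemxAl w'Q scaler0.
  have : ok (k + 1)%N.
    exists (col_mx Q e); split.
      rewrite tr_col_mx mul_col_row QQ eQ ee.
      have -> : Q *m e^T = 0 by rewrite -[LHS]trmxK trmx_mul trmxK eQ trmx0.
      by rewrite -scalar_mx_block.
    move=> i; case: (split_ordP i) => j ->; rewrite ?rowKu// rowKd.
    have -> : row j e = e by apply/rowP => l; rewrite mxE ord1.
    by rewrite /e -[X in U X]addr0; apply: sU.2 => //; exact: sU.1.
  by move=> /asboolP/kmax; rewrite addn1 ltnn.
exists (v *m Q^T *m Q) => // w /spanU ->.
rewrite trmx_mul mulmxA; have -> : (v - v *m Q^T *m Q) *m Q^T = 0.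
  by rewrite mulmxBl -!mulmxA QQ mulmx1 subrr.
by rewrite mul0mx.
Qed.

End Projection.

Section FiniteMaps.
Context {R : realType} {d : nat} {G : groupClosed (euclid R d)}.
Variable Rg : set (carrier G).
Hypothesis Rgfin : finite_set Rg.
Implicit Types (u v w p : carrier G -> 'cV[R]_d) (U : set (carrier G -> 'cV[R]_d)).

Let X := fset_set Rg.
Let inX h : (h \in X) = (h \in Rg). Proof. by rewrite in_fset_set. Qed.

Lemma dot_onE u v : dot_on Rg u v = \sum_(h <- X) ((u h)^T *m v h) 0 0.
Proof. by rewrite /dot_on fsbig_finite. Qed.

Lemma sqr_norm_on u : norm_on Rg u ^+ 2 = dot_on Rg u u.
Proof.
rewrite /norm_on sqr_sqrtr; first by apply: eq_fsbigr => h _; rewrite sqr_fnorm_dot.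
by apply: fsumr_ge0 => h _; exact: sqr_ge0.
Qed.

Lemma norm_on_ge0 u : 0 <= norm_on Rg u. Proof. exact: sqrtr_ge0. Qed.

Lemma fnorm_le_norm_on u h : Rg h -> fnorm (u h) <= norm_on Rg u.
Proof.
move=> Rh; rewrite -(@ler_pXn2r _ 2) ?nnegrE ?fnorm_ge0 ?norm_on_ge0//.
rewrite sqr_norm_on dot_onE sqr_fnorm_dot.
have hX : h \in X by rewrite inX inE.
rewrite (big_fsetD1 h)//= lerDl; apply: sumr_ge0 => k _.
by rewrite -sqr_fnorm_dot sqr_ge0.
Qed.

Let coords u : 'rV[R]_#|{: X * 'I_d}| :=
  \row_k u (val (enum_val k).1) (enum_val k).2 0.

Let coords_dot u v : (coords u *m (coords v)^T) 0 0 = dot_on Rg u v.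
Proof.
rewrite dot_onE big_seq_fsetE /=; under [RHS]eq_bigr do rewrite mxE.
rewrite pair_big/= mxE [RHS](reindex _ (onW_bij _ (enum_val_bij _))) /=.
by apply: eq_bigr => k _; rewrite !mxE.
Qed.

Let coordsD a u v : coords (a *: u + v) = a *: coords u + coords v.
Proof. by apply/rowP => k; rewrite !mxE. Qed.

Lemma maps_on_subspace : subspace (maps_on Rg).
Proof.
split=> [g _//|a u v hu hv g Ng]; change (a *: u g + v g = 0).
by rewrite hu// hv// scaler0 addr0.
Qed.

Lemma proj_kerP U v : subspace U -> U `<=` maps_on Rg -> maps_on Rg v ->
  let p := proj_ker Rg U v in
  [/\ maps_on Rg p, U (v - p) & forall w, U w -> dot_on Rg p w = 0].
Proof.
move=> sU UR vR /=; apply: (@xgetPex _ _ [set p | [/\ maps_on Rg p, U (v - p) &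
                              forall w, U w -> dot_on Rg p w = 0]]).
have sU' : subspace (coords @` U).
  split; first by exists 0; [exact: sU.1|apply/rowP => k; rewrite !mxE].
  move=> a _ _ [u Uu <-] [w Uw <-]; exists (a *: u + w); first exact: sU.2.
  exact: coordsD.
have [_ [u Uu <-] orth] := row_projection (coords v) sU'.
exists (v - u); split.
- exact: (subspaceB maps_on_subspace vR (UR _ Uu)).
- by rewrite opprB addrC subrK.
- move=> w Uw; have := orth (coords w) (imageP _ Uw) => /(congr1 (fun M : 'M[R]_(1, 1) => M 0 0)).
  have -> : coords v - coords u = coords (v - u).
    by rewrite -scaleN1r addrC -coordsD scaleN1r addrC.
  by rewrite coords_dot mxE.
Qed.

(** Pythagoras: [p0 - p] lies in [U], hence is orthogonal to [p]. *)
Lemma norm_proj_ker_le U U0 v : subspace U -> subspace U0 -> U0 `<=` U ->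
  U `<=` maps_on Rg -> maps_on Rg v ->
  norm_on Rg (proj_ker Rg U v) <= norm_on Rg (proj_ker Rg U0 v).
Proof.
move=> sU sU0 U0U UR vR.
have [pR Up porth] := proj_kerP sU UR vR.
have [p0R Up0 _] := proj_kerP sU0 (subset_trans U0U UR) vR.
set p := proj_ker _ U v in pR Up porth *; set p0 := proj_ker _ U0 v in p0R Up0 *.
have Ue : U (p0 - p).
  have -> : p0 - p = (v - p) - (v - p0) by rewrite opprB [RHS]addrC addrA subrK.
  by apply: subspaceB => //; exact: U0U.
rewrite -(@ler_pXn2r _ 2) ?nnegrE ?norm_on_ge0// !sqr_norm_on.
have -> : dot_on Rg p0 p0 = dot_on Rg p p + dot_on Rg p (p0 - p) *+ 2 + dot_on Rg (p0 - p) (p0 - p).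
  rewrite !dot_onE -sumrMnl -!big_split /=; apply: eq_bigr => h _.
  change ((p0 - p) h) with (p0 h - p h); rewrite !mxE -sumrMnl -!big_split /=.
  by apply: eq_bigr => i _; rewrite !mxE; ring.
by rewrite (porth (p0 - p))// mul0rn addr0 lerDl -sqr_norm_on sqr_ge0.
Qed.

End FiniteMaps.

Section Patch.
Context {R : realType} {d : nat} {I : Type}.
Implicit Types (f : I -> 'cV[R]_d) (A : set I).

(* The library restricts with the default value [point] of the codomain. *)
Lemma patchE0 f A i : (f \_ A) i = if i \in A then f i else 0.
Proof.
by rewrite /patch; case: ifP => // _; apply/matrixP => k l; rewrite !mxE.
Qed.

Lemma patch_in f A i : A i -> (f \_ A) i = f i.
Proof. by move=> Ai; rewrite patchE0 ifT// inE. Qed.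

Lemma patch_out f A i : ~ A i -> (f \_ A) i = 0.
Proof. by move=> Ai; rewrite patchE0 ifF//; apply/negbTE; rewrite notin_setE. Qed.

End Patch.

Section LocalApproximation.
Context {R : realType} {d : nat} {G : groupClosed (euclid R d)}.
Variable (x0 : 'cV[R]_d).
Hypothesis stab_fin : finite_set (stab (G := G) x0).
Implicit Types (u v : carrier G -> 'cV[R]_d) (A : set (carrier G)).

Let n0 : R := #|` fset_set (stab (G := G) x0)|%:R.

Lemma stab1 : stab (G := G) x0 1%g. Proof. exact: act_one. Qed.

Lemma stabM (g h : carrier G) : stab x0 g -> stab x0 h -> stab x0 (g * h)%g.
Proof.
by move=> hg hh; change (act (val (g * h)%g) x0 = x0); rewrite valM act_mul hh.
Qed.

Lemma stabV (g : carrier G) : stab x0 g -> stab x0 g^-1%g.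
Proof.
move=> hg; change (act (val g^-1%g) x0 = x0).
by rewrite -{1}hg -act_mul -valM mulVg; exact: act_one.
Qed.

Lemma card_stab_gt0 : 0 < n0.
Proof.
rewrite ltr0n lt0n cardfs_eq0; apply/eqP => e.
have : (1%g : carrier G) \in fset_set (stab (G := G) x0) by rewrite in_fset_set// inE; exact: stab1.
by rewrite e in_fset0.
Qed.

Lemma stab_meanD A f f' a : finite_set A ->
  stab_mean x0 A (fun h => a *: f h + f' h) = a *: stab_mean x0 A f + stab_mean x0 A f'.
Proof.
move=> fA; rewrite /stab_mean !fsbig_finite// big_split -scaler_sumr scalerDr /=.
by rewrite !scalerA mulrC.
Qed.

Lemma eq_stab_mean A f f' : (forall h, A h -> f h = f' h) -> stab_mean x0 A f = stab_mean x0 A f'.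
Proof. by move=> ff'; congr (_ *: _); apply: eq_fsbigr => h /set_mem; exact: ff'. Qed.

Lemma ubarD a u v g : ubar x0 (a *: u + v) g = a *: ubar x0 u g + ubar x0 v g.
Proof.
rewrite /ubar -stab_meanD//; apply: eq_stab_mean => h _.
by change ((a *: u + v) (g * h)%g) with (a *: u (g * h)%g + v (g * h)%g); rewrite mulmxDr scalemxAr.
Qed.

Lemma stab_mean_norm f M : (forall h, stab x0 h -> `|f h| <= M) ->
  `|stab_mean x0 (stab (G := G) x0) f| <= M.
Proof.
move=> fM; rewrite /stab_mean normrZ ger0_norm ?invr_ge0// mulrC ler_pdivrMr ?card_stab_gt0//.
rewrite fsbig_finite//; apply: le_trans (ler_norm_sum _ _ _) _.
rewrite /n0 mulr_natr -[leRHS]iter_addr_0 -(count_predT (fset_set _)) -big_const_seq.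
rewrite big_seq [leRHS]big_seq; apply: ler_sum => h; rewrite in_fset_set// inE; exact: fM.
Qed.

Variables (Rg : set (carrier G)).
Hypothesis Rgfin : finite_set Rg.
Hypothesis Rgstab : [set (g * h)%g | g in Rg & h in stab x0] = Rg.

Lemma range_stab g h : Rg g -> stab x0 h -> Rg (g * h)%g.
Proof. by move=> gR hs; rewrite -Rgstab; exists g => //; exists h. Qed.

Lemma Uiso_subspace (K : set 'M[R]_d) : subspace K -> subspace (Uiso Rg K x0).
Proof.
move=> [K0 KD]; split.
  split; first exact: (maps_on_subspace Rg).1.
  exists 0; exists 0 => // g gR; rewrite mul0mx addr0.
  have -> : ubar x0 0 g = 0.
    by rewrite /ubar /stab_mean fsbig1 ?scaler0// => h _; exact: mulmx0.
  by rewrite mulmx0.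
move=> a u v [uR [b [S KS hu]]] [vR [b' [S' KS' hv]]]; split.
  exact: (maps_on_subspace Rg).2.
exists (a *: b + b'); exists (a *: S + S'); first exact: KD.
move=> g gR; rewrite ubarD mulmxDr -scalemxAr hu// hv// mulmxDl -scalemxAl scalerDr.
by rewrite addrACA.
Qed.

Lemma patch_maps_on u : maps_on Rg (u \_ Rg).
Proof. by move=> g Ng; rewrite patch_out. Qed.

(** The projection [p] is what remains of the patch after removing an exact element of [Uiso]. It
    enters through [ubar], a mean of rotated values of [p] over a stabilizer coset contained in
    [Rg]. *)
Lemma local_approximation (K : set 'M[R]_d) u : subspace K ->
  exists a, exists2 S, K S & forall h, Rg h ->
    `|lin (val h) *m ubar x0 u h - (a + S *m (act (val h) x0 - x0))| <=
    d%:R * norm_on Rg (proj_ker Rg (Uiso Rg K x0) (u \_ Rg)).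
Proof.
move=> sK; have := proj_kerP Rgfin (Uiso_subspace sK) _ (@patch_maps_on u).
set p := proj_ker _ _ _ => -[|pR [_ [a [S KS qa]]] _]; first by move=> v [].
exists a, S => // h hR; rewrite -qa// -mulmxBr; apply: le_trans (norm_lin _ _) _.
rewrite ler_wpM2l//.
have -> : ubar x0 u h - ubar x0 (u \_ Rg - p) h = ubar x0 p h.
  have -> : ubar x0 u h = ubar x0 (u \_ Rg) h.
    by apply: eq_stab_mean => h' hs; rewrite patch_in//; exact: range_stab.
  apply/eqP; by rewrite subr_eq -[ubar _ p h]scale1r -ubarD// scale1r addrC subrK.
apply: stab_mean_norm => h' hs; apply: le_trans (norm_le_fnorm _) _; rewrite fnorm_lin.
by apply: fnorm_le_norm_on => //; exact: range_stab.
Qed.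

End LocalApproximation.

(** * Rigidity *)

Section Rigidity.
Context {R : realType} {d : nat} {G : groupClosed (euclid R d)}.
Variables (x0 : 'cV[R]_d) (Rg R1 R2 : set (carrier G)).
Hypothesis R12 : [set (g * h)%g | g in R1 & h in R2] `<=` Rg.
Hypothesis one12 : (R1 `&` R2) 1%g.
Hypothesis R1gen : generates R1.
Hypothesis R2aff : aff (orbit_of x0 R2) = aff (orbit_of x0 [set: carrier G]).

(** The affine maps are evaluated at orbit points, not at positions relative to the patch, so that
    those of different patches can be compared at one point. *)
Definition patchwise_affine (n : carrier G -> R) (w a : carrier G -> 'cV[R]_d)
    (S : carrier G -> 'M[R]_d) : Prop :=
  forall g h, Rg h ->
    `|w (g * h)%g - (a g + S g *m act (val (g * h)%g) x0)| <= n g.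

Lemma act_affine (g : euclid R d) m (c : 'I_m -> R) (p : 'I_m -> 'cV[R]_d) :
  \sum_i c i = 1 -> act g (\sum_i c i *: p i) = \sum_i c i *: act g (p i).
Proof.
move=> c1; rewrite /act mulmx_sumr -[trans g in LHS]scale1r -c1 scaler_suml -big_split.
by apply: eq_bigr => i _ /=; rewrite scalerDr scalemxAr.
Qed.

Let Rg_R2 h : R2 h -> Rg h.
Proof. by move=> h2; apply: R12; exists 1%g; [exact: one12.1|exists h => //; rewrite mul1g]. Qed.

Let Rg1 : Rg 1%g. Proof. exact: Rg_R2 one12.2. Qed.

Let patchwise_affine_ge0 n w a S g : patchwise_affine n w a S -> 0 <= n g.
Proof. by move=> /(_ g 1%g Rg1); apply: le_trans; exact: normr_ge0. Qed.

(* These [h] form a subgroup containing the generators [R1], hence are all of [G]. *)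
Definition patches_agree (h : carrier G) : Prop := forall k, exists2 C : R, 0 <= C &
  exists s : seq (carrier G), forall n w a S, patchwise_affine n w a S -> forall g,
  `|(a g + S g *m act (val (g * k)%g) x0) -
    (a (g * h)%g + S (g * h)%g *m act (val (g * k)%g) x0)| <= C * \sum_(j <- s) n (g * j)%g.

(** Quantifying over all evaluation points [k] is what gives closure: from the base point [g * h1]
    the point [g * k] is reached by [h1^-1 * k]. The constants depend on neither the field nor
    [g]. *)
Lemma patches_agree_subgroup : is_subgroup patches_agree.
Proof.
split.
- move=> k; exists 0 => //; exists [::] => n w a S _ g.
  by rewrite mulg1 subrr normr0 mul0r.
- move=> h1 h2 P1 P2 k.
  have [C1 C10 [s1 b1]] := P1 k; have [C2 C20 [s2 b2]] := P2 (h1^-1 * k)%g.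
  exists (C1 + C2); first exact: addr_ge0.
  exists (s1 ++ [seq (h1 * j)%g | j <- s2]) => n w a S hd g.
  have := b2 n w a S hd (g * h1)%g; have := b1 n w a S hd g.
  rewrite !mulgA mulgK big_cat big_map /=.
  under [X in C2 * X]eq_bigr do rewrite -mulgA.
  set x := a g + _; set y := a (g * h1)%g + _; set z := a (g * h1 * h2)%g + _.
  set t1 := \sum_(i <- s1) _; set t2 := \sum_(i <- s2) _ => le1 le2.
  apply: (le_trans (ler_distD y _ _)); apply: (le_trans (lerD le1 le2)).
  have t10 : 0 <= t1 by apply: sumr_ge0 => j _; exact: patchwise_affine_ge0 hd.
  have t20 : 0 <= t2 by apply: sumr_ge0 => j _; exact: patchwise_affine_ge0 hd.
  rewrite mulrDl !mulrDr; have := mulr_ge0 C10 t20; have := mulr_ge0 C20 t10; lra.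
- move=> h Ph k; have [C C0 [s b]] := Ph (h * k)%g.
  exists C => //; exists [seq (h^-1 * j)%g | j <- s] => n w a S hd g.
  have := b n w a S hd (g * h^-1)%g; rewrite !mulgA !mulgVK big_map distrC.
  by under [X in C * X]eq_bigr do rewrite -mulgA.
Qed.

(** Write [r^-1 k . x0] as an affine combination of points [q . x0] with [q] in [R2]. Each [g r q]
    lies in the patches at [g] and at [g r], where both affine maps are close to [w]; the
    combination costs the sum of the absolute coefficients. *)
Lemma patches_agree_generator : R1 `<=` patches_agree.
Proof.
move=> r Rr k.
have : aff (orbit_of x0 [set: carrier G]) (act (val (r^-1 * k)%g) x0).
  exists 1%N, (fun=> 1), (fun=> act (val (r^-1 * k)%g) x0); split.
  - by move=> _; exists (r^-1 * k)%g.
  - by rewrite big_ord1.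
  - by rewrite big_ord1 scale1r.
rewrite -R2aff => -[m [c [p [pR2 c1 kE]]]].
exists (\sum_i `|c i|); first exact: sumr_ge0.
exists [:: 1%g; r] => n w a S hd g; rewrite !big_cons big_nil addr0 mulg1.
have e1 : act (val (g * k)%g) x0 = \sum_i c i *: act (val (g * r)%g) (p i).
  rewrite -act_affine// -kE -act_mul -valM; congr (act (val _) _).
  by rewrite !mulgA mulgK.
have affE (b : 'cV[R]_d) (M : 'M[R]_d) :
    b + M *m act (val (g * k)%g) x0 = \sum_i c i *: (b + M *m act (val (g * r)%g) (p i)).
  rewrite e1 mulmx_sumr -[b in LHS]scale1r -c1 scaler_suml -big_split.
  by apply: eq_bigr => i _ /=; rewrite -scalemxAr -scalerDr.
rewrite !affE -sumrB; apply: le_trans (ler_norm_sum _ _ _) _.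
rewrite mulr_suml; apply: ler_sum => i _.
rewrite -scalerBr normrZ ler_wpM2l//.
have [q Rq qp] := pR2 i.
have Rrq : Rg (r * q)%g by apply: R12; exists r => //; exists q.
have := hd g _ Rrq; have := hd (g * r)%g _ (Rg_R2 Rq); rewrite -!mulgA.
have -> : act (val (g * (r * q))%g) x0 = act (val (g * r)%g) (p i).
  by rewrite -qp -act_mul -valM mulgA.
move=> le1 le2; apply: (le_trans (ler_distD (w (g * (r * q))%g) _ _)).
by rewrite lerD// distrC.
Qed.

(** At [g * h] the field is close to the affine map of that patch, which [patches_agree] replaces by
    the one at [g]. Evaluating at the two centres adds the errors [n g] and [n (g * h)]. *)
Lemma rigidity_point h : exists2 C : R, 0 <= C &
  exists s : seq (carrier G), forall n w a S, patchwise_affine n w a S -> forall g,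
  `|w (g * h)%g - w g - S g *m (act (val (g * h)%g) x0 - act (val g) x0)| <=
    C * \sum_(j <- s) n (g * j)%g.
Proof.
have : patches_agree h.
  by rewrite (R1gen patches_agree_subgroup patches_agree_generator).
move=> /(_ h)[C C0 [s b]]; exists (C + 1); first by rewrite addr_ge0.
exists [:: 1%g, h & s] => n w a S hd g; have {b} := b n w a S hd g.
rewrite !big_cons mulg1 mulmxBr; set t := \sum_(j <- s) _.
have := hd (g * h)%g _ Rg1; have := hd g _ Rg1; rewrite !mulg1.
set y := S g *m act (val (g * h)%g) x0; set y' := S g *m act (val g) x0.
set z := S (g * h)%g *m _ => le1 le2 le3.
have -> : w (g * h)%g - w g - (y - y') = (w (g * h)%g - (a (g * h)%g + z)) -
    (a g + y - (a (g * h)%g + z)) - (w g - (a g + y')).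
  by apply/matrixP => i j; rewrite !mxE; ring.
apply: le_trans (ler_normB _ _) _; apply: le_trans (lerD (ler_normB _ _) le1) _.
have n1 := patchwise_affine_ge0 g hd; have n2 := patchwise_affine_ge0 (g * h)%g hd.
have t0 : 0 <= t by apply: sumr_ge0 => j _; exact: patchwise_affine_ge0 hd.
have := mulr_ge0 C0 n1; have := mulr_ge0 C0 n2.
rewrite mulrDl mul1r !mulrDr; lra.
Qed.

Lemma rigidity (A : seq (carrier G)) : exists2 C : R, 0 <= C &
  exists s : seq (carrier G), forall n w a S, patchwise_affine n w a S -> forall g h, h \in A ->
  `|w (g * h)%g - w g - S g *m (act (val (g * h)%g) x0 - act (val g) x0)| <=
    C * \sum_(j <- s) n (g * j)%g.
Proof.
elim: A => [|h0 A [C C0 [s b]]]; first by exists 0 => //; exists [::].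
have [C1 C10 [s1 b1]] := rigidity_point h0.
exists (C + C1); first exact: addr_ge0.
exists (s ++ s1) => n w a S hd g h; rewrite big_cat /=.
set t := \sum_(j <- s) _; set t1 := \sum_(j <- s1) _.
have t0 : 0 <= t by apply: sumr_ge0 => j _; exact: patchwise_affine_ge0 hd.
have t10 : 0 <= t1 by apply: sumr_ge0 => j _; exact: patchwise_affine_ge0 hd.
have le (x y z : R) : 0 <= y -> 0 <= z -> x <= C * t \/ x <= C1 * t1 -> x <= (C + C1) * (t + t1).
  move=> y0 z0; rewrite mulrDl !mulrDr.
  have := mulr_ge0 C0 t0; have := mulr_ge0 C0 t10; have := mulr_ge0 C10 t0; have := mulr_ge0 C10 t10.
  by move=> p1 p2 p3 p4 [] ?; lra.
rewrite inE => /orP[/eqP ->|hA]; apply: (le _ 0 0) => //.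
  by right; exact: (b1 n w a S).
by left; exact: (b n w a S).
Qed.

End Rigidity.

(** * The supremum norm and rotations *)

Section SupNorm.
Context {R : realType} {d : nat} {I : Type}.
Implicit Types (z u v : I -> 'cV[R]_d).

Lemma fnormZ m n (a : R) (A : 'M[R]_(m, n)) : fnorm (a *: A) = `|a| * fnorm A.
Proof.
rewrite /fnorm -sqrtr_sqr -sqrtrM ?sqr_ge0//; congr Num.sqrt.
rewrite mulr_sumr; apply: eq_bigr => i _; rewrite mulr_sumr.
by apply: eq_bigr => j _; rewrite mxE exprMn.
Qed.

Lemma supnorm_has_ubound z : Linfty z -> has_ubound [set fnorm (z i) | i in setT].
Proof. by move=> [M hM]; exists M => _ [i _ <-]. Qed.

Lemma fnorm_le_supnorm z i : Linfty z -> fnorm (z i) <= supnorm z.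
Proof. by move=> /supnorm_has_ubound h; apply: ub_le_sup => //; exists i. Qed.

Lemma supnorm_le z M : 0 <= M -> (forall i, fnorm (z i) <= M) -> supnorm z <= M.
Proof.
move=> M0 zM; have [[x Ax]|/set0P/negP/negPn/eqP A0] := pselect ([set fnorm (z i) | i in setT] !=set0).
  by apply: ge_sup; [exists x|move=> _ [i _ <-]].
by rewrite /supnorm A0 sup0.
Qed.

Lemma supnorm_ge0 z : Linfty z -> 0 <= supnorm z.
Proof.
move=> zb; have [[x [i _ _]]|/set0P/negP/negPn/eqP A0] := pselect ([set fnorm (z i) | i in setT] !=set0).
  by apply: le_trans (fnorm_le_supnorm i zb); exact: fnorm_ge0.
by rewrite /supnorm A0 sup0.
Qed.

Lemma fctD u v i : (u + v) i = u i + v i. Proof. by []. Qed.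
Lemma fctZ (a : R) u i : (a *: u) i = a *: u i. Proof. by []. Qed.
Lemma fctB u v i : (u - v) i = u i - v i. Proof. by []. Qed.

Lemma supnormZ_le a z : Linfty z -> supnorm (a *: z) <= `|a| * supnorm z.
Proof.
move=> zb; apply: supnorm_le; first by rewrite mulr_ge0// supnorm_ge0.
by move=> i; rewrite fctZ fnormZ ler_wpM2l// fnorm_le_supnorm.
Qed.

Lemma norm_le_Linfty z M : (forall i, `|z i| <= M) -> Linfty z.
Proof.
move=> zM; exists (d%:R * M) => i; apply: le_trans (fnorm_le_norm _) _.
by rewrite ler_wpM2l.
Qed.

Lemma supnorm_le_norm z M : 0 <= M -> (forall i, `|z i| <= M) -> supnorm z <= d%:R * M.
Proof.
move=> M0 zM; apply: supnorm_le => [|i]; first exact: mulr_ge0.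
by apply: le_trans (fnorm_le_norm _) _; rewrite ler_wpM2l.
Qed.

Lemma Linfty_norm z : Linfty z -> exists2 M, 0 <= M & forall i, `|z i| <= M.
Proof.
move=> [M hM]; exists (Num.max 0 M); first by rewrite le_max lexx.
by move=> i; rewrite le_max (le_trans (norm_le_fnorm _) (hM i)) orbT.
Qed.

Lemma Linfty_subspace : subspace (@Linfty R d I).
Proof.
split; first by apply: (@norm_le_Linfty _ 0) => i; rewrite normr0.
move=> a u v /Linfty_norm[M M0 hM] /Linfty_norm[M' M'0 hM'].
apply: (@norm_le_Linfty _ (`|a| * M + M')) => i; rewrite fctD fctZ.
by apply: le_trans (ler_normD _ _) _; rewrite lerD// normrZ ler_wpM2l.
Qed.

Lemma LinftyD u v : Linfty u -> Linfty v -> Linfty (u + v).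
Proof. by move=> hu hv; rewrite -[u]scale1r; exact: Linfty_subspace.2. Qed.

Lemma LinftyZ a u : Linfty u -> Linfty (a *: u).
Proof. by move=> hu; rewrite -[_ *: _]addr0; apply: Linfty_subspace.2 => //; exact: Linfty_subspace.1. Qed.

Lemma supnormD_le u v : Linfty u -> Linfty v ->
  supnorm (u + v) <= d%:R * (supnorm u + supnorm v).
Proof.
move=> hu hv; apply: supnorm_le_norm => [|i]; first by rewrite addr_ge0// supnorm_ge0.
apply: le_trans (ler_normD _ _) _.
by rewrite lerD// (le_trans (norm_le_fnorm _))// fnorm_le_supnorm.
Qed.

Lemma patch_Linfty (A : set I) z : finite_set A -> Linfty (z \_ A).
Proof.
move=> fA; have [s As] : exists s : seq R, forall i, A i -> `|z i| \in s.
  have /finite_seqP[s sE] := finite_image (fun i => `|z i|) fA.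
  by exists s => i Ai; have : [set` s] `|z i| by rewrite -sE; exists i.
apply: (@norm_le_Linfty _ (\sum_(x <- s) `|x|)) => i; rewrite patchE0.
case: ifPn => [|_]; last by rewrite normr0 sumr_ge0.
by rewrite inE => /As zs; rewrite (big_rem _ zs)/= normr_id lerDl sumr_ge0.
Qed.

End SupNorm.

Section Limits.
Context {R : realType}.

Lemma eps_eq0 (x c : R) : (forall e, 0 < e -> e <= 1 -> `|x| <= e * c) -> x = 0.
Proof.
move=> h; apply/eqP; rewrite -normr_le0; apply/ler_addgt0Pr => e e0; rewrite add0r.
pose e' := Num.min 1 (e / (`|c| + 1)).
have c1 : 0 < `|c| + 1 by rewrite ltr_wpDl.
have e'0 : 0 < e' by rewrite lt_min ltr01 divr_gt0.
apply: le_trans (h e' e'0 _) _; first by rewrite ge_min lexx.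
have : e' <= e / (`|c| + 1) by rewrite ge_min lexx orbT.
rewrite ler_pdivlMr// => le1; apply: le_trans le1; rewrite ler_wpM2l ?(ltW e'0)//.
by apply: le_trans (ler_norm c) _; rewrite lerDl.
Qed.

End Limits.

Section Rotation.
Context {R : realType} {d : nat}.

(* A rational parametrization of the rotations generated by [S], valid if [S ^ 3 = - S]. *)
Definition rot_coef (t : R) : R := 2 * t / (1 + t ^+ 2).

Definition rot (S : 'M[R]_d) (t : R) : 'M[R]_d :=
  1%:M + rot_coef t *: (S + t *: (S *m S)).

Lemma rot_coef_gt0 t : 0 < t -> 0 < rot_coef t.
Proof. by move=> t0; rewrite /rot_coef divr_gt0 ?mulr_gt0// ltr_wpDr// sqr_ge0. Qed.

Lemma rot_coef_le t : 0 < t -> rot_coef t <= 2 * t.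
Proof.
move=> t0; rewrite /rot_coef ler_pdivrMr ?ltr_wpDr ?sqr_ge0//.
by rewrite ler_peMr ?mulr_ge0 ?(ltW t0)// lerDl sqr_ge0.
Qed.

(** [rot S t] is the Cayley transform of [t S]. Because [S ^ 3 = - S], the product reduces to [1]
    plus a multiple of [S ^ 2], and [rot_coef] is the value that makes this multiple vanish. *)
Lemma rot_orthogonal (S : 'M[R]_d) t : S^T = - S -> S *m S *m S = - S ->
  orthogonal_mx (rot S t).
Proof.
move=> ST S3; rewrite /orthogonal_mx /rot.
have S4 : S *m S *m (S *m S) = - (S *m S) by rewrite mulmxA S3 mulNmx.
have trD (A B : 'M[R]_d) : (A + B)^T = A^T + B^T by rewrite linearD.
have trZ a (A : 'M[R]_d) : (a *: A)^T = a *: A^T by rewrite linearZ.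
rewrite !trD !trZ trD trZ trmx1 trmx_mul ST mulmxN mulNmx opprK.
set c := rot_coef t; set P := S *m S in S3 S4 *.
have -> : (1%:M + c *: (- S + t *: P)) *m (1%:M + c *: (S + t *: P)) =
    1%:M + (c * t * 2 - c ^+ 2 - (c * t) ^+ 2) *: P.
  have SP : S *m P = - S by rewrite mulmxA.
  rewrite mulmxDl mul1mx -scalemxAl mulmxDr mulmx1 -scalemxAr !mulmxDl !mulmxDr.
  rewrite !mulNmx -!scalemxAl -!scalemxAr S3 S4 SP -/P.
  by apply/matrixP => i j; rewrite !mxE; ring.
have -> : c * t * 2 - c ^+ 2 - (c * t) ^+ 2 = 0.
  rewrite /c /rot_coef; field.
  by rewrite gt_eqF// ltr_wpDr// sqr_ge0.
by rewrite scale0r addr0.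
Qed.

(** General skew matrices violate [S ^ 3 = - S]; these satisfy it and span the skew matrices. *)
Definition plane_generator (ij : 'I_d * 'I_d) : 'M[R]_d :=
  delta_mx ij.1 ij.2 - delta_mx ij.2 ij.1.

Lemma plane_generator_skew ij : (plane_generator ij)^T = - plane_generator ij.
Proof. by rewrite /plane_generator linearB /= !trmx_delta opprB. Qed.

Lemma plane_generator_cube ij :
  plane_generator ij *m plane_generator ij *m plane_generator ij = - plane_generator ij.
Proof.
case: ij => i j; rewrite /plane_generator /=.
have [->|ij] := eqVneq i j; first by rewrite subrr mulmx0 oppr0.
have ji : j != i by rewrite eq_sym.
have -> : (delta_mx i j - delta_mx j i) *m (delta_mx i j - delta_mx j i) =
    - (delta_mx i i + delta_mx j j) :> 'M[R]_d.
  rewrite !(mulmxBl, mulmxBr) (@mul_delta_mx_0 _ _ _ _ _ _ _ _ ij) (@mul_delta_mx_0 _ _ _ _ _ _ _ _ ji) !mul_delta_mx.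
  by apply/matrixP => k l; rewrite !mxE; ring.
rewrite mulNmx !(mulmxDl, mulmxBr) !mul_delta_mx (@mul_delta_mx_0 _ _ _ _ _ _ _ _ ij) (@mul_delta_mx_0 _ _ _ _ _ _ _ _ ji).
by congr (- _); apply/matrixP => k l; rewrite !mxE; ring.
Qed.

Lemma skew_decomposition (S : 'M[R]_d) : S^T = - S ->
  S = \sum_ij (S ij.1 ij.2 / 2) *: plane_generator ij.
Proof.
move=> ST; have Sskew i j : S j i = - S i j by have /matrixP/(_ i j) := ST; rewrite !mxE.
have e1 : S = \sum_(ij : 'I_d * 'I_d) S ij.1 ij.2 *: delta_mx ij.1 ij.2.
  by rewrite [LHS]matrix_sum_delta pair_big.
have e2 : S = - \sum_(ij : 'I_d * 'I_d) S ij.1 ij.2 *: delta_mx ij.2 ij.1.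
  rewrite -[LHS]opprK -ST; congr (- _); rewrite {1}e1 linear_sum /=.
  by apply: eq_bigr => ij _; rewrite linearZ /= trmx_delta.
have : S = 2^-1 *: (S + S) by rewrite scalerDr -scalerDl [_ + _](_ : _ = 1) ?scale1r//; field.
rewrite {3}e2 {2}e1 => {1}->; rewrite -sumrB scaler_sumr; apply: eq_bigr => ij _.
by apply/matrixP => k l; rewrite /plane_generator !mxE; ring.
Qed.

End Rotation.

(** * The Hessian of the potential at the equilibrium *)

Section PotentialCalculus.
Context {R : realType} {d : nat} {I : Type}.
Local Notation conf := (I -> 'cV[R]_d).
Variables (V : conf -> R) (RV : set I) (y0 : conf).
Hypothesis V_rot : forall (A : 'M[R]_d) y, orthogonal_mx A -> V (fun g => A *m y g) = V y.
Hypothesis RVfin : finite_set RV.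
Hypothesis V_range : forall y, V y = V (y \_ RV).
Let f (z : conf) : R := V (y0 + z).
Hypothesis f_C2 : frechet_C2 Linfty supnorm f.
Let D := frechet Linfty supnorm f.
Let B := frechet2 Linfty supnorm f 0.
Hypothesis equilibrium : forall z, Linfty z -> D 0 z = 0.
Implicit Types (x z v h : conf) (S A : 'M[R]_d).
Local Notation L := (@Linfty R d I).
Local Notation N := (@supnorm R d I).

(** The field [S y] may be unbounded; its restriction to [RV] lies in [Linfty], and [V] does not see
    the cut. *)
Definition range_mul S (y : conf) : conf := (fun c => S *m y c) \_ RV.

Lemma range_mul_Linfty S y : L (range_mul S y).
Proof. exact: patch_Linfty. Qed.

Lemma range_mulE S y i : range_mul S y i = if i \in RV then S *m y i else 0.
Proof. exact: patchE0. Qed.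

Lemma range_mulDl a S S' y : range_mul (a *: S + S') y = a *: range_mul S y + range_mul S' y.
Proof.
apply/funext => i; rewrite fctD fctZ !range_mulE; case: ifP => _.
  by rewrite mulmxDl scalemxAl.
by rewrite scaler0 addr0.
Qed.

Lemma range_mulDr a S y y' : range_mul S (y + a *: y') = range_mul S y + a *: range_mul S y'.
Proof.
apply/funext => i; rewrite fctD fctZ !range_mulE; case: ifP => _.
  by rewrite fctD fctZ mulmxDr scalemxAr.
by rewrite scaler0 addr0.
Qed.

Let eqV y y' : (forall i, RV i -> y i = y' i) -> V y = V y'.
Proof.
move=> yy'; rewrite V_range [RHS]V_range; congr V; apply/funext => i.
by rewrite !patchE0; case: ifP => // /set_mem; exact: yy'.
Qed.

Let L0 : L 0. Proof. exact: (@Linfty_subspace R d I).1. Qed.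

Let D_lin x : L x -> linear_on L (D x).
Proof. by move=> /f_C2[[[]]]. Qed.

Let lin0 (l : conf -> R) : linear_on L l -> l 0 = 0.
Proof. by move=> /(_ (-1) 0 0 L0 L0); rewrite scaler0 addr0 mulN1r addNr. Qed.

Let linZ (l : conf -> R) a u : linear_on L l -> L u -> l (a *: u) = a * l u.
Proof. by move=> ll Lu; have := ll a u 0 Lu L0; rewrite addr0 lin0 ?addr0. Qed.

Let linD (l : conf -> R) u v : linear_on L l -> L u -> L v -> l (u + v) = l u + l v.
Proof. by move=> ll Lu Lv; have := ll 1 u v Lu Lv; rewrite scale1r mul1r. Qed.

Let D_approx x : L x -> forall e, 0 < e -> exists2 r, 0 < r &
  forall z, L z -> N z < r -> `|f (x + z) - f x - D x z| <= e * N z.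
Proof. by move=> /f_C2[[]]. Qed.

Let B_spec : is_frechet2 L N f 0 B.
Proof. by have [] := f_C2 L0. Qed.

Let B_linl v : L v -> linear_on L (B^~ v). Proof. by case: B_spec => -[+ _] _ _ => /[apply]. Qed.
Let B_linr v : L v -> linear_on L (B v). Proof. by case: B_spec => -[_ +] _ _ => /[apply]. Qed.

Let B_approx e : 0 < e -> exists2 r, 0 < r &
    forall z v, L z -> L v -> N z < r -> `|D z v - B z v| <= e * N z * N v.
Proof.
case: B_spec => _ _ h /h[r r0 hr]; exists r => // z v Lz Lv Nz.
by have := hr z v Lz Lv Nz; rewrite -/D equilibrium// subr0 add0r.
Qed.

Lemma supnorm_scale_small z (r : R) : L z -> 0 < r -> exists2 t0, 0 < t0 &
  forall t, 0 < t -> t <= t0 -> N (t *: z) < r.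
Proof.
move=> Lz r0; have N0 := supnorm_ge0 Lz; exists (r / (N z + 1)).
  by rewrite divr_gt0// ltr_wpDl.
move=> t t0; rewrite ler_pdivlMr ?ltr_wpDl// => le1.
apply: le_lt_trans (supnormZ_le _ Lz) _; rewrite gtr0_norm//.
by apply: lt_le_trans le1; rewrite mulrDr mulr1 ltrDl.
Qed.

(* The displacement [rot S t - 1] is, to first order in [t], a positive multiple of [S]. *)
Let rot_step S t (y : conf) : conf :=
  rot_coef t *: (range_mul S y + t *: range_mul (S *m S) y).

Let rot_step_Linfty S t y : L (rot_step S t y).
Proof.
by apply/LinftyZ/LinftyD; [exact: range_mul_Linfty|apply/LinftyZ; exact: range_mul_Linfty].
Qed.

Let rot_stepE S t y i : RV i -> y i + rot_step S t y i = rot S t *m y i.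
Proof.
move=> RVi; rewrite /rot_step fctZ fctD fctZ !range_mulE mem_set//.
rewrite /rot mulmxDl mul1mx -scalemxAl mulmxDl -scalemxAl //.
Qed.

(** The step is [rot_coef t] times [p + t q]; dividing by this factor leaves [|l p + t l q| <= e c]
    with [t <= e], and [e] is arbitrary. *)
Lemma rotation_tangent S y (l : conf -> R) : linear_on L l ->
  (forall e, 0 < e -> exists2 r, 0 < r & forall t, 0 < t -> N (rot_step S t y) < r ->
    `|l (rot_step S t y)| <= e * N (rot_step S t y)) ->
  l (range_mul S y) = 0.
Proof.
move=> ll hl; set p := range_mul S y; set q := range_mul (S *m S) y.
have Lp : L p by exact: range_mul_Linfty.
have Lq : L q by exact: range_mul_Linfty.
have p0 := supnorm_ge0 Lp; have q0 := supnorm_ge0 Lq.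
pose c := d%:R * (N p + N q).
have c0 : 0 <= c by rewrite mulr_ge0// addr_ge0.
apply: (@eps_eq0 _ _ (`|l q| + c)) => e e0 e1.
have [r r0 hr] := hl e e0.
(* The second bound gives [2 t c < r], which puts the step inside the radius. *)
pose t := Num.min e (r / (2 * c + 1)).
have c1 : 0 < 2 * c + 1 by rewrite ltr_wpDl// mulr_ge0.
have t0 : 0 < t by rewrite lt_min e0 divr_gt0.
have te : t <= e by rewrite ge_min lexx.
have rc := rot_coef_gt0 t0.
have Npq : N (p + t *: q) <= c.
  apply: le_trans (supnormD_le Lp (LinftyZ t Lq)) _; rewrite ler_wpM2l// lerD2l.
  apply: le_trans (supnormZ_le _ Lq) _; rewrite gtr0_norm// ler_piMl//.
  exact: le_trans te e1.
have Lpq : L (p + t *: q) by apply: LinftyD => //; exact: LinftyZ.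
have Ns : N (rot_step S t y) <= rot_coef t * c.
  apply: le_trans (supnormZ_le _ Lpq) _.
  by rewrite gtr0_norm// ler_wpM2l// ltW.
have : `|l (rot_step S t y)| <= e * N (rot_step S t y).
  apply: hr => //; apply: le_lt_trans Ns _.
  apply: (@le_lt_trans _ _ (2 * t * c)); first by rewrite ler_wpM2r// rot_coef_le.
  have : t <= r / (2 * c + 1) by rewrite ge_min lexx orbT.
  rewrite ler_pdivlMr// => le1; apply: lt_le_trans le1.
  by rewrite -subr_gt0 [ltRHS](_ : _ = t)//; ring.
rewrite /rot_step linZ// (linD ll)//; last exact: LinftyZ.
rewrite (linZ _ ll)// normrM (gtr0_norm rc) => le1.
have {le1} : `|l p + t * l q| <= e * c.
  rewrite -(ler_pM2l rc); apply: le_trans le1 _.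
  by rewrite mulrCA ler_wpM2l ?(ltW e0).
move=> le1; have -> : l p = (l p + t * l q) - t * l q by rewrite addrK.
apply: le_trans (ler_normB _ _) _; rewrite mulrDr addrC lerD// normrM gtr0_norm//.
by rewrite ler_wpM2r.
Qed.

Section Generator.
Variable S : 'M[R]_d.
Hypotheses (S_skew : S^T = - S) (S_cube : S *m S *m S = - S).

Let rotS t := rot_orthogonal t S_skew S_cube.

Let f_rot_step t x : f (x + rot_step S t (y0 + x)) = f x.
Proof.
rewrite /f -(V_rot (y0 + x) (rotS t)); apply: eqV => i RVi.
by rewrite -rot_stepE// !fctD addrA.
Qed.

(** Invariance is differentiated at every [x], not only at the equilibrium, because [B_rotation_r]
    expands the resulting identity once more. *)
Let D_rotation x : L x -> D x (range_mul S (y0 + x)) = 0.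
Proof.
move=> Lx; apply: rotation_tangent; first exact: D_lin.
move=> e /(D_approx Lx)[r r0 hr]; exists r => // t t0 Nt.
by have := hr _ (rot_step_Linfty _ _ _) Nt; rewrite f_rot_step subrr sub0r normrN.
Qed.

(** Near the rotated equilibrium [f] takes the values it has near [0] in the direction [h], which is
    [v] rotated back on [RV]; hence that point is critical too. *)
Let D_rotated t v : L v -> D (rot_step S t y0) v = 0.
Proof.
move=> Lv; set zt := rot_step S t y0; have Lzt : L zt by exact: rot_step_Linfty.
pose h := v + range_mul ((rot S t)^T - 1%:M) v.
have Lh : L h by apply: LinftyD => //; exact: range_mul_Linfty.
have AAT : rot S t *m (rot S t)^T = 1%:M by apply: mulmx1C; exact/eqP/rotS.
have fs s : f (zt + s *: v) = f (s *: h).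
  rewrite /f -(V_rot (y0 + s *: h) (rotS t)); apply: eqV => i RVi.
  rewrite !fctD addrA /zt rot_stepE// !fctZ /h fctD range_mulE mem_set//.
  by rewrite mulmxBl mul1mx [v i + _]addrC subrK mulmxDr -scalemxAr mulmxA AAT mul1mx.
have fzt : f zt = f 0 by have := fs 0; rewrite !scale0r addr0.
apply: (@eps_eq0 _ _ (N h + N v)) => e e0 _.
have [r r0 hr] := D_approx L0 e0; have [r1 r10 hr1] := D_approx Lzt e0.
have [s1 s10 hs1] := supnorm_scale_small Lh r0.
have [s2 s20 hs2] := supnorm_scale_small Lv r10.
pose s := Num.min s1 s2.
have s0 : 0 < s by rewrite lt_min s10.
have := hr _ (LinftyZ s Lh) (hs1 s s0 _); rewrite ge_min lexx => /(_ isT).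
rewrite equilibrium; last exact: LinftyZ.
rewrite add0r subr0 => le1.
have := hr1 _ (LinftyZ s Lv) (hs2 s s0 _); rewrite ge_min lexx orbT => /(_ isT).
rewrite (linZ _ (D_lin Lzt))// fs fzt => le2.
have Nh := supnormZ_le s Lh; have Nv := supnormZ_le s Lv; rewrite gtr0_norm// in Nh Nv.
rewrite -(ler_pM2l s0) -{1}(gtr0_norm s0) -normrM.
have -> : s * D zt v = (f (s *: h) - f 0) - (f (s *: h) - f 0 - s * D zt v) by ring.
apply: le_trans (ler_normB _ _) _; apply: le_trans (lerD le1 le2) _.
rewrite -mulrDr mulrCA ler_wpM2l ?(ltW e0)// mulrDr; exact: lerD.
Qed.

Let B_rotation_l v : L v -> B (range_mul S y0) v = 0.
Proof.
move=> Lv; apply: (@rotation_tangent S y0 (B^~ v)); first exact: B_linl.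
move=> e e0; have Nv := supnorm_ge0 Lv; have v1 : 0 < N v + 1 by rewrite ltr_wpDl.
have [r r0 hr] := B_approx (divr_gt0 e0 v1).
exists r => // t t0 Nt; have Lz := rot_step_Linfty S t y0.
have := hr _ _ Lz Lv Nt; rewrite D_rotated// sub0r normrN => /le_trans; apply.
have z0 := supnorm_ge0 Lz; rewrite mulrAC ler_wpM2r// mulrAC ler_pdivrMr//.
by rewrite ler_wpM2l ?(ltW e0)// lerDl.
Qed.

(** At [x = s z], [D_rotation] reads [D (s z) p = - s D (s z) q]. The right side is of order
    [s ^ 2], while the left side is [s B z p] up to [o(s)]. *)
Let B_rotation_r z : L z -> B z (range_mul S y0) = 0.
Proof.
move=> Lz; set p := range_mul S y0; set q := range_mul S z.
have Lp : L p by exact: range_mul_Linfty.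
have Lq : L q by exact: range_mul_Linfty.
have [[p0 q0] z0] := (supnorm_ge0 Lp, supnorm_ge0 Lq, supnorm_ge0 Lz).
apply: (@eps_eq0 _ _ (N z * N p + (`|B z q| + N z * N q))) => e e0 e1.
have [r r0 hr] := B_approx e0; have [s1 s10 hs1] := supnorm_scale_small Lz r0.
pose s := Num.min e s1; have s0 : 0 < s by rewrite lt_min e0.
have se : s <= e by rewrite ge_min lexx.
have Ns : N (s *: z) < r by apply: hs1 => //; rewrite ge_min lexx orbT.
have Lsz : L (s *: z) by exact: LinftyZ.
have Nsz : N (s *: z) <= s * N z by have := supnormZ_le s Lz; rewrite gtr0_norm.
have := hr _ _ Lsz Lp Ns; have := hr _ _ Lsz Lq Ns.
rewrite (linZ _ (B_linl Lp))// (linZ _ (B_linl Lq))//.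
have : D (s *: z) p = - (s * D (s *: z) q).
  have := D_rotation Lsz; rewrite range_mulDr (linD (D_lin Lsz))//; last exact: LinftyZ.
  by rewrite (linZ _ (D_lin Lsz))// => /eqP; rewrite addr_eq0 => /eqP.
set Dp := D _ p; set Dq := D _ q => eqD le1 le2.
have le3 : `|Dq| <= s * (`|B z q| + e * N z * N q).
  have -> : Dq = (Dq - s * B z q) + s * B z q by rewrite subrK.
  apply: le_trans (ler_normD _ _) _; rewrite normrM gtr0_norm// mulrDr addrC lerD2l.
  apply: le_trans le1 _; have -> : s * (e * N z * N q) = e * (s * N z) * N q by ring.
  by rewrite ler_wpM2r// ler_wpM2l ?(ltW e0).
have le4 : s * `|B z p| <= s * (e * N z * N p + s * (`|B z q| + e * N z * N q)).
  have -> : s * `|B z p| = `|- (s * Dq) - (Dp - s * B z p)|.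
    rewrite eqD -{1}(gtr0_norm s0) -normrM; congr `|_|; ring.
  apply: le_trans (ler_normB _ _) _; rewrite normrN normrM (gtr0_norm s0) addrC mulrDr.
  apply: lerD; last by rewrite ler_wpM2l ?(ltW s0).
  apply: le_trans le2 _; have -> : s * (e * N z * N p) = e * (s * N z) * N p by ring.
  by rewrite ler_wpM2r// ler_wpM2l ?(ltW e0).
rewrite ler_pM2l// in le4; apply: le_trans le4 _; rewrite [leRHS]mulrDr [e * (N z * N p)]mulrA lerD2l.
have B0 := normr_ge0 (B z q); have zq := mulr_ge0 z0 q0.
apply: ler_pM => //; first exact: ltW.
  by rewrite addr_ge0// -mulrA mulr_ge0// ltW.
by rewrite lerD2l -mulrA ler_piMl.
Qed.

Lemma hessian_generator v : L v ->
  B (range_mul S y0) v = 0 /\ B v (range_mul S y0) = 0.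
Proof. by split; [exact: B_rotation_l|exact: B_rotation_r]. Qed.

End Generator.

Lemma hessian_skew S v : S^T = - S -> L v ->
  B (range_mul S y0) v = 0 /\ B v (range_mul S y0) = 0.
Proof.
move=> /skew_decomposition -> Lv.
pose U := [set S | B (range_mul S y0) v = 0 /\ B v (range_mul S y0) = 0].
apply: (@subspace_sum _ _ U) => [|ij]; last first.
  by apply: hessian_generator => //; [exact: plane_generator_skew|exact: plane_generator_cube].
have LL S' : L (range_mul S' y0) by exact: range_mul_Linfty.
split.
  have e0 : range_mul 0 y0 = 0.
    by apply/funext => i; rewrite range_mulE mul0mx; case: ifP.
  by rewrite /U /= e0 (lin0 (B_linl Lv)) (lin0 (B_linr Lv)).
move=> a S1 S2 [h1 h1'] [h2 h2']; rewrite /U /= range_mulDl.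
by rewrite (B_linl Lv)// (B_linr Lv)// h1 h2 h1' h2' mulr0 addr0.
Qed.

Lemma hessian_bound : exists2 K : R, 0 < K & forall S S' u v, S^T = - S -> S'^T = - S' ->
  L u -> L v -> `|B u v| <= K * N (u - range_mul S y0) * N (v - range_mul S' y0).
Proof.
case: B_spec => _ [K K0 hK] _; exists K => // S S' u v sS sS' Lu Lv.
have LL S1 : L (range_mul S1 y0) by exact: range_mul_Linfty.
have LB u1 S1 : L u1 -> L (u1 - range_mul S1 y0).
  by move=> L1; rewrite -scaleN1r; apply: LinftyD => //; exact: LinftyZ.
have e1 w : L w -> B u w = B (u - range_mul S y0) w.
  move=> Lw; have := linD (B_linl Lw) (LB u S Lu) (LL S).
  by rewrite subrK (hessian_skew sS Lw).1 addr0.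
have e2 w : L w -> B w v = B w (v - range_mul S' y0).
  move=> Lw; have := linD (B_linr Lw) (LB v S' Lv) (LL S').
  by rewrite subrK (hessian_skew sS' Lw).2 addr0.
rewrite e1// e2; last exact: LB.
exact: hK (LB _ _ Lu) (LB _ _ Lv).
Qed.

Lemma hessian_limit u v : L u -> L v -> forall e, 0 < e -> exists2 t0, 0 < t0 &
  forall t, 0 < t -> t <= t0 -> `|D (t *: u) v - t * B u v| <= e * t.
Proof.
move=> Lu Lv e e0; have [Nu Nv] := (supnorm_ge0 Lu, supnorm_ge0 Lv).
have c0 : 0 < N u * N v + 1 by rewrite ltr_wpDl// mulr_ge0.
have [r r0 hr] := B_approx (divr_gt0 e0 c0).
have [t0 t00 ht0] := supnorm_scale_small Lu r0.
exists t0 => // t tpos tt0; have Ltu := LinftyZ t Lu.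
have := hr _ _ Ltu Lv (ht0 t tpos tt0); rewrite (linZ _ (B_linl Lv))// => /le_trans; apply.
have Ntu : N (t *: u) <= t * N u by have := supnormZ_le t Lu; rewrite gtr0_norm.
apply: (@le_trans _ _ (e / (N u * N v + 1) * (t * N u * N v))).
  by rewrite -mulrA ler_wpM2l ?divr_ge0 ?(ltW e0) ?(ltW c0)// ler_wpM2r.
have -> : e / (N u * N v + 1) * (t * N u * N v) = e * t * (N u * N v / (N u * N v + 1)) by ring.
by rewrite ler_piMr ?mulr_ge0 ?(ltW e0) ?(ltW tpos)// ler_pdivrMr// mul1r lerDl.
Qed.

Lemma directional_limit x v : L x -> L v -> forall e, 0 < e -> exists2 s0, 0 < s0 &
  forall s, 0 < s -> s <= s0 -> `|f (x + s *: v) - f x - s * D x v| <= e * s.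
Proof.
move=> Lx Lv e e0; have Nv := supnorm_ge0 Lv.
have c0 : 0 < N v + 1 by rewrite ltr_wpDl.
have [r r0 hr] := D_approx Lx (divr_gt0 e0 c0).
have [s0 s00 hs0] := supnorm_scale_small Lv r0.
exists s0 => // s spos ss0; have Lsv := LinftyZ s Lv.
have := hr _ Lsv (hs0 s spos ss0); rewrite (linZ _ (D_lin Lx))// => /le_trans; apply.
have Nsv : N (s *: v) <= s * N v by have := supnormZ_le s Lv; rewrite gtr0_norm.
apply: (@le_trans _ _ (e / (N v + 1) * (s * N v))).
  by rewrite ler_wpM2l ?divr_ge0 ?(ltW e0) ?(ltW c0).
have -> : e / (N v + 1) * (s * N v) = e * s * (N v / (N v + 1)) by ring.
by rewrite ler_piMr ?mulr_ge0 ?(ltW e0) ?(ltW spos)// ler_pdivrMr// mul1r lerDl.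
Qed.

End PotentialCalculus.

(** * The second derivative of the energy *)

Section Displacement.
Context {R : realType} {d : nat} {G : groupClosed (euclid R d)}.
Variable x0 : 'cV[R]_d.
Hypothesis stab_fin : finite_set (stab (G := G) x0).
Implicit Types (g h k : carrier G) (u v z : carrier G -> 'cV[R]_d) (c : cosets_star G x0).

Definition shift g u : carrier G -> 'cV[R]_d := fun h => u (g * h)%g.

(** The mean of [L(k h) u(k h)] over the stabilizer, that is, the displacement of the point
    [k . x0]. *)
Definition coset_field u k : 'cV[R]_d := lin (val k) *m ubar x0 u k.

Definition coset_rep c : carrier G := xget 1%g (val c).

(* The first-order change of the energy argument at the identity under the displacement [u]. *)
Definition displacement u c : 'cV[R]_d :=
  coset_field u (coset_rep c) - coset_field u 1%g.

Lemma coset_repE c : val c = left_coset x0 (coset_rep c).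
Proof.
have [[g _ gc] _] := set_mem (valP c).
have : (val c) (coset_rep c).
  by apply: (@xgetPex _ _ (val c)); exists g; rewrite -gc; exists 1%g; [exact: stab1|rewrite mulg1].
rewrite -gc => -[h0 hs0 <-]; apply/seteqP; split => [_ [h hs <-]|_ [h hs <-]].
  by exists (h0^-1 * h)%g; [apply: stabM => //; exact: stabV|rewrite -mulgA mulVKg].
by exists (h0 * h)%g; [exact: stabM|rewrite mulgA].
Qed.

Lemma stab_mean_coset k (F : carrier G -> 'cV[R]_d) :
  stab_mean x0 (left_coset x0 k) F = stab_mean x0 (stab x0) (fun h => F (k * h)%g).
Proof. by rewrite /stab_mean fsbig_image// => h h' _ _; exact: mulgI. Qed.

Lemma stab_mean_cst (b : 'cV[R]_d) : stab_mean x0 (stab (G := G) x0) (fun=> b) = b.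
Proof.
rewrite /stab_mean fsbig_finite// big_const_seq count_predT iter_addr_0.
by rewrite -(scaler_nat _ b) scalerA mulVf ?scale1r// gt_eqF// card_stab_gt0.
Qed.

Lemma stab_mean_lin (M : 'M[R]_d) (F : carrier G -> 'cV[R]_d) :
  stab_mean x0 (stab x0) (fun h => M *m F h) = M *m stab_mean x0 (stab x0) F.
Proof. by rewrite /stab_mean !fsbig_finite// -mulmx_sumr scalemxAr. Qed.

Lemma actD (g : euclid R d) (x y : 'cV[R]_d) : act g (x + y) = act g x + lin g *m y.
Proof. by rewrite /act mulmxDr addrAC. Qed.

Lemma stab_mean_moved g k z :
  stab_mean x0 (left_coset x0 k)
    (fun h => act (val (g * h)%g) (x0 + z (g * h)%g)) =
  act (val g) (act (val k) x0 + coset_field (shift g z) k).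
Proof.
rewrite stab_mean_coset.
have -> : act (val g) (act (val k) x0 + coset_field (shift g z) k) =
    1 *: stab_mean x0 (stab (G := G) x0) (fun=> act (val g) (act (val k) x0)) +
    stab_mean x0 (stab x0) (fun h => lin (val g) *m (lin (val k) *m (lin (val h) *m z (g * (k * h))%g))).
  rewrite stab_mean_cst scale1r !stab_mean_lin actD /coset_field.
  by congr (_ + _ *m (_ *m _)); apply: eq_stab_mean => h _; rewrite /shift mulgA.
rewrite -stab_meanD//; apply: eq_stab_mean => h hs.
rewrite scale1r !valM !act_mul; set y := z _.
by rewrite actD (hs : act (val h) x0 = x0) !actD.
Qed.

Lemma left_coset1 : left_coset x0 1%g = stab (G := G) x0.
Proof.
apply/seteqP; split => [_ [h hs <-]|h hs]; first by rewrite mul1g.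
by exists h => //; rewrite mul1g.
Qed.

(** The rotation [lin (val g)] is common to all entries, so invariance of [V] removes it and the
    energy becomes a mean of values of [V] near [y0]. *)
Lemma energy_argument g z c :
  stab_mean x0 (val c) (fun h => act (val (g * h)%g) (x0 + z (g * h)%g)) -
  stab_mean x0 (stab x0) (fun h => act (val (g * h)%g) (x0 + z (g * h)%g)) =
  lin (val g) *m (y0 G x0 c + displacement (shift g z) c).
Proof.
rewrite coset_repE stab_mean_moved -left_coset1 stab_mean_moved actB; congr (_ *m _).
rewrite /y0 /displacement -/(coset_rep c) [act (val 1%g) x0]act_one.
by rewrite opprD addrACA.
Qed.

Lemma coset_field_shift g u k : coset_field u (g * k)%g = lin (val g) *m coset_field (shift g u) k.
Proof.
rewrite /coset_field valM lin_mul mulmxA; congr (_ *m _).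
by apply: eq_stab_mean => h _; rewrite /shift mulgA.
Qed.

Lemma coset_fieldD a u v k : coset_field (a *: u + v) k = a *: coset_field u k + coset_field v k.
Proof. by rewrite /coset_field ubarD// mulmxDr scalemxAr. Qed.

Lemma displacementD a u v : displacement (a *: u + v) = a *: displacement u + displacement v.
Proof.
apply/funext => c; rewrite fctD fctZ /displacement !coset_fieldD scalerBr.
by rewrite opprD addrACA.
Qed.

End Displacement.
Arguments displacement {R d G} x0 u c.

Section UniformSmallness.
Context {R : realType}.

Lemma finite_small (A : choiceType) (D : set A) (P : A -> R -> Prop) : finite_set D ->
  (forall g, D g -> exists2 s0, 0 < s0 & forall s, 0 < s -> s <= s0 -> P g s) ->
  exists2 s0, 0 < s0 & forall s, 0 < s -> s <= s0 -> forall g, D g -> P g s.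
Proof.
move=> /finite_seqP[l ->]; elim: l => [|g l IH] h; first by exists 1.
have [s1 s10 h1] := h g (mem_head _ _).
have [|s2 s20 h2] := IH; first by move=> k kl; apply: h; rewrite /= inE; apply/orP; right.
exists (Num.min s1 s2); first by rewrite lt_min s10.
move=> s s0; rewrite le_min => /andP[ss1 ss2] k; rewrite /= inE => /orP[/eqP ->|kl].
  exact: h1.
exact: h2.
Qed.

End UniformSmallness.

Section Energy.
Context {R : realType} {d1 d2 : nat}.
Local Notation d := (d1 + d2)%N.
Context {G : groupClosed (euclid R d)} {S : groupClosed (euclid R d2)}.
Variables (T : set (carrier G)) (C : nat -> set (carrier G)) (x0 : 'cV[R]_d).
Variable V : (cosets_star G x0 -> 'cV[R]_d) -> R.
Hypothesis hGS : normal_form G S.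
Hypothesis hT : translation_lift S T.
Hypothesis hC : forall N, M0 T N -> representatives (powers T N) (C N).
Hypothesis hV : interaction_potential V.
Variable RV : set (cosets_star G x0).
Hypothesis RVfin : finite_set RV.
Hypothesis V_range : forall y, V y = V (y \_ RV).
Hypothesis hequil : forall z, Linfty z -> dV V (y0 G x0) z = 0.
Implicit Types (g h : carrier G) (u v z : carrier G -> 'cV[R]_d).

Let f (z : cosets_star G x0 -> 'cV[R]_d) : R := V (y0 G x0 + z).
Let D := frechet Linfty supnorm f.
Let B := frechet2 Linfty supnorm f 0.

Let stab_fin : finite_set (stab (G := G) x0).
Proof. by apply: finite_stab; case: hGS. Qed.

Let V_rot (A : 'M[R]_d) y : orthogonal_mx A -> V (fun c => A *m y c) = V y.
Proof. by case: hV => + _ _; apply. Qed.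

Let f_C2 : frechet_C2 Linfty supnorm f.
Proof. by case: hV => _ + _; apply. Qed.

Let hequil' (y : cosets_star G x0 -> 'cV[R]_d) : Linfty y -> D 0 y = 0.
Proof. exact: hequil. Qed.

Definition local_displacement u g := (displacement x0 (shift g u)) \_ RV.
Local Notation U := local_displacement.

Lemma local_displacement_Linfty u g : Linfty (U u g).
Proof. exact: patch_Linfty. Qed.

Lemma local_displacementD a u v g : U (a *: u + v) g = a *: U u g + U v g.
Proof.
apply/funext => c; rewrite fctD fctZ /U !patchE0; case: ifP => _.
  have -> : shift g (a *: u + v) = a *: shift g u + shift g v by [].
  by rewrite displacementD.
by rewrite scaler0 addr0.
Qed.

Lemma local_displacement0 g : U 0 g = 0.
Proof. by have := local_displacementD (-1) 0 0 g; rewrite scaler0 addr0 scaleN1r addNr. Qed.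

Lemma local_displacementZ a u g : U (a *: u) g = a *: U u g.
Proof. by have := local_displacementD a u 0 g; rewrite local_displacement0 !addr0. Qed.

Lemma energyE z N : M0 T N -> periodic_wrt T N z ->
  energy V T C ((fun=> x0) + z) = coset_mean (C N) (fun g => f (U z g)).
Proof.
move=> hN pz; pose w : carrier G -> 'cV[R]_d := (fun=> x0) + z.
have FE g : V (fun c => stab_mean x0 (val c) (fun h => act (val (g * h)%g) (w (g * h)%g)) -
    stab_mean x0 (stab x0) (fun h => act (val (g * h)%g) (w (g * h)%g))) = f (U z g).
  rewrite /f -(V_rot (y0 G x0 + U z g) (introT eqP (linP (val g)))) V_range [RHS]V_range; congr V.
  apply/funext => c; rewrite !patchE0; case: ifPn => // /set_mem RVc.
  by rewrite energy_argument// fctD /U patch_in.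
rewrite /energy (period_mean_eq hGS hT hC hN).
- by apply: eq_coset_mean => g; exact: FE.
- by move=> g t /pz zt; rewrite !fctD zt.
- move=> N' hN' pw g t Pt; rewrite !FE /U; congr (f (displacement x0 _ \_ RV)).
  have := periodic_shift g hN' pw Pt => /(congr1 (fun F => (fun h => F h - x0))).
  by move=> e; apply/funext => h; have := congr1 (fun F => F h) e; rewrite !fctD !(addrC x0) !addrK.
Qed.

Lemma Uper_Linfty u : Uper T u -> Linfty u.
Proof.
move=> [N hN pu]; have [M hM] := @patch_Linfty R d _ (C N) u (finite_C hGS hT hC hN).
exists M => g; have [c [[Cc [t Pt ct]] _]] := hC hN g.
by have := hM c; rewrite patch_in// ct pu.
Qed.

Lemma periodic_lin N a u v : periodic_wrt T N u -> periodic_wrt T N v ->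
  periodic_wrt T N (a *: u + v).
Proof. by move=> pu pv g t Pt; rewrite !fctD !fctZ pu// pv. Qed.

Lemma common_period u v : Uper T u -> Uper T v ->
  exists N, [/\ M0 T N, periodic_wrt T N u & periodic_wrt T N v].
Proof.
move=> [N hN pu] [N' hN' pv]; exists (N * N')%N; split.
- by apply: (M0_mul hGS hT hN); case: hN'.
- exact: periodic_mul.
- by rewrite mulnC; apply: periodic_mul.
Qed.

Let DE := frechet (Uper T) supnorm (energy V T C).

(** The first case is the default of [xget]. Otherwise difference quotients along [v] identify the
    derivative; their convergence is uniform because the mean runs over finitely many cosets. *)
Lemma energy_derivative N z v : M0 T N -> periodic_wrt T N z -> periodic_wrt T N v ->
  DE ((fun=> x0) + z) v = 0 \/
  DE ((fun=> x0) + z) v = coset_mean (C N) (fun g => D (U z g) (U v g)).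
Proof.
move=> hN pz pv; rewrite /DE /frechet; case: xgetP => [l _ [[ll _] hl]|_]; last by left.
right; have Uv : Uper T v by exists N.
have Lv := Uper_Linfty Uv; have Nv := supnorm_ge0 Lv; have fC := finite_C hGS hT hC hN.
have ll0 : l 0 = 0.
  have U0 : Uper T 0 by exists N.
  by have := ll (-1) 0 0 U0 U0; rewrite scaler0 addr0 mulN1r addNr.
have llZ a : l (a *: v) = a * l v.
  have U0 : Uper T 0 by exists N.
  by have := ll a v 0 Uv U0; rewrite ll0 !addr0.
apply/eqP; rewrite -subr_eq0; apply/eqP; apply: (@eps_eq0 _ _ (supnorm v + 1)) => e e0 _.
have [r r0 hr] := hl e e0; have [s1 s10 hs1] := supnorm_scale_small Lv r0.
pose P g s := `|f (U z g + s *: U v g) - f (U z g) - s * D (U z g) (U v g)| <= e * s.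
have [|s2 s20 hs2] := @finite_small _ _ (C N) P fC.
  move=> g _; apply: (directional_limit f_C2 _ _ e0); exact: local_displacement_Linfty.
pose s := Num.min s1 s2; have s0 : 0 < s by rewrite lt_min s10.
have Usv : Uper T (s *: v).
  by exists N => //; rewrite -[s *: v]addr0; apply: periodic_lin.
have Ns : supnorm (s *: v) < r by apply: hs1 => //; rewrite ge_min lexx.
have Nsv : supnorm (s *: v) <= s * supnorm v by have := supnormZ_le s Lv; rewrite gtr0_norm.
have := hr _ Usv Ns; rewrite llZ -(addrA (fun=> x0) z) !(@energyE _ N)//; last first.
  by rewrite (addrC z); apply: periodic_lin.
have -> : (fun g => f (U (z + s *: v) g)) = (fun g => f (U z g + s *: U v g)).
  by apply/funext => g; rewrite (addrC z) local_displacementD (addrC (U z g)).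
rewrite coset_meanB// => le1.
have le2 : `|coset_mean (C N) (fun g => f (U z g + s *: U v g) - f (U z g)) -
    s * coset_mean (C N) (fun g => D (U z g) (U v g))| <= e * s.
  rewrite -coset_meanZ// coset_meanB//; apply: le_trans (coset_mean_norm _ fC) _.
  rewrite -[leRHS](coset_mean_cst (e * s) fC (hC hN)); apply: ler_coset_mean => // g Cg.
  by apply: hs2 => //; rewrite ge_min lexx orbT.
set X := coset_mean _ _ in le1 le2; set Y := coset_mean _ _ in le2 *.
rewrite -(ler_pM2l s0) -{1}(gtr0_norm s0) -normrM.
have -> : s * (l v - Y) = (X - s * Y) - (X - s * l v) by ring.
apply: le_trans (ler_normB _ _) _; rewrite addrC; apply: le_trans (lerD le1 le2) _.
have -> : s * (e * (supnorm v + 1)) = e * (s * supnorm v) + e * s by ring.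
by rewrite lerD2r ler_wpM2l ?(ltW e0).
Qed.

(* Where [energy] is not differentiable [frechet] returns [0], so that difference
   quotients of [frechet energy] along [u] are either [0] or converge to the mean. *)
Lemma energy2_le N u v : M0 T N -> periodic_wrt T N u -> periodic_wrt T N v ->
  `|energy2 V T C u v| <= coset_mean (C N) (fun g => `|B (U u g) (U v g)|).
Proof.
move=> hN pu pv; have fC := finite_C hGS hT hC hN.
rewrite /energy2 /frechet2; case: xgetP => [E2 _ [[E2l _] _ hE]|_]; last first.
  by rewrite normr0; apply: coset_mean_ge0.
have [Uu Uv] : Uper T u /\ Uper T v by split; exists N.
have U0 : Uper T 0 by exists N.
have [Lu Lv] := (Uper_Linfty Uu, Uper_Linfty Uv).
have [Nu Nv] := (supnorm_ge0 Lu, supnorm_ge0 Lv).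
apply: le_trans (coset_mean_norm (fun g => B (U u g) (U v g)) fC).
set M := coset_mean _ _; apply/ler_addgt0Pr => e0 e00.
pose c := supnorm u * supnorm v + 1.
have c0 : 0 < c by rewrite ltr_wpDl// mulr_ge0.
pose e := e0 / c; have e_gt0 : 0 < e by rewrite divr_gt0.
have [r r0 hr] := hE e e_gt0; have [s1 s10 hs1] := supnorm_scale_small Lu r0.
pose P g s := `|D (s *: U u g) (U v g) - s * B (U u g) (U v g)| <= e * s.
have [|s2 s20 hs2] := @finite_small _ _ (C N) P fC.
  move=> g _; apply: (hessian_limit f_C2 hequil' _ _ e_gt0); exact: local_displacement_Linfty.
pose s := Num.min s1 s2; have s0 : 0 < s by rewrite lt_min s10.
have psu : periodic_wrt T N (s *: u).
  by rewrite -[s *: u]addr0; apply: periodic_lin.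
have Usu : Uper T (s *: u) by exists N.
have Ns : supnorm (s *: u) < r by apply: hs1 => //; rewrite ge_min lexx.
have Nsu : supnorm (s *: u) <= s * supnorm u by have := supnormZ_le s Lu; rewrite gtr0_norm.
(* Both alternatives give zero: the default, or a mean of derivatives at the equilibrium. *)
have DE0 : DE (fun=> x0) v = 0.
  have p0 : periodic_wrt T N (0 : carrier G -> 'cV[R]_d) by [].
  have := energy_derivative hN p0 pv; rewrite addr0 => -[//|->]; rewrite /coset_mean fsbig1 ?mulr0// => g _.
  rewrite local_displacement0; apply: hequil'; exact: local_displacement_Linfty.
have E2Z : E2 (s *: u) v = s * E2 u v.
  have E20 : E2 0 v = 0.
    by have := E2l v Uv (-1) 0 0 U0 U0; rewrite scaler0 addr0 mulN1r addNr.
  by have := E2l v Uv s u 0 Uu U0; rewrite E20 !addr0.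
have := hr _ _ Usu Uv Ns; rewrite -/DE DE0 subr0 E2Z => le1.
have {le1} le1 : `|DE ((fun=> x0) + s *: u) v - s * E2 u v| <= s * (e * (supnorm u * supnorm v)).
  apply: le_trans le1 _; have -> : s * (e * (supnorm u * supnorm v)) = e * (s * supnorm u) * supnorm v by ring.
  by rewrite ler_wpM2r// ler_wpM2l ?(ltW e_gt0).
have ec : e * (supnorm u * supnorm v) + e = e0 by rewrite -[X in _ + X]mulr1 -mulrDr -/c divfK// gt_eqF.
(* In the default case the approximation alone makes [E2 u v] at most [e0]. *)
have [DE1|DE1] := @energy_derivative N (s *: u) v hN psu pv.
  move: le1; rewrite DE1 sub0r normrN normrM gtr0_norm// ler_pM2l// => /le_trans; apply.
  by have := normr_ge0 M; lra.
have le2 : `|DE ((fun=> x0) + s *: u) v - s * M| <= s * e.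
  rewrite DE1 -coset_meanZ// coset_meanB//; apply: le_trans (coset_mean_norm _ fC) _.
  rewrite -[leRHS](coset_mean_cst (s * e) fC (hC hN)); apply: ler_coset_mean => // g Cg.
  rewrite local_displacementZ [s * e]mulrC; apply: hs2 => //; by rewrite ge_min lexx orbT.
have le3 : s * `|E2 u v - M| <= s * e0.
  rewrite -{1}(gtr0_norm s0) -normrM.
  have -> : s * (E2 u v - M) = (DE ((fun=> x0) + s *: u) v - s * M) -
    (DE ((fun=> x0) + s *: u) v - s * E2 u v) by ring.
  apply: le_trans (ler_normB _ _) _; rewrite addrC; apply: le_trans (lerD le1 le2) _.
  by rewrite -mulrDr ec.
rewrite ler_pM2l// in le3; rewrite -[E2 u v](subrK M).
by apply: le_trans (ler_normD _ _) _; rewrite addrC lerD2l.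
Qed.

End Energy.

(** * Boundedness and the stability constants *)

Lemma sqr_sum_le (R : realType) (I : Type) (s : seq I) (a : I -> R) :
  (\sum_(i <- s) a i) ^+ 2 <= (size s)%:R * \sum_(i <- s) a i ^+ 2.
Proof.
have := cauchy_schwarz_sum s (fun=> 1) a.
under eq_bigr do rewrite mul1r; move=> /le_trans; apply.
rewrite ler_wpM2r//; first by apply: sumr_ge0 => i _; exact: sqr_ge0.
under eq_bigr do rewrite expr1n.
by rewrite big_const_seq count_predT iter_addr_0.
Qed.

(** The number [- c] is admissible because [s <= s'], and the single field [u] bounds all admissible
    numbers from above. *)
Lemma ereal_sup_ratio_fin_num (R : realType) (X : Type) (W : set X) (q s s' : X -> R) (c : R) :
  0 < c -> (forall v, W v -> `|q v| <= c * s v * s v) ->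
  (forall v, W v -> 0 <= s v <= s' v) -> (exists2 u, W u & 0 < s u) ->
  ereal_sup [set b%:E | b in [set b : R | forall u, W u -> b * s' u ^+ 2 <= q u]] \is a fin_num.
Proof.
move=> c0 hc ss' [u Wu su].
have su' : 0 < s' u ^+ 2.
  by rewrite exprn_gt0//; apply: lt_le_trans su _; case/andP: (ss' u Wu).
rewrite fin_numElt; apply/andP; split.
  apply: (@lt_le_trans _ _ (- c)%:E); first exact: ltNyr.
  apply: ereal_sup_ubound; exists (- c) => // v Wv.
  have := hc v Wv; rewrite ler_norml => /andP[+ _]; apply: le_trans.
  have /andP[s0 ss] := ss' v Wv.
  rewrite mulNr lerN2 -mulrA -expr2 ler_wpM2l ?(ltW c0)//.
  by rewrite ler_pXn2r ?nnegrE// (le_trans s0).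
apply: (@le_lt_trans _ _ (q u / s' u ^+ 2)%:E); last exact: ltry.
by apply: ge_ereal_sup => _ [b hb <-]; rewrite lee_fin ler_pdivlMr//; exact: hb.
Qed.

Section Boundedness.
Context {R : realType} {d1 d2 : nat}.
Local Notation d := (d1 + d2)%N.
Context {G : groupClosed (euclid R d)} {S : groupClosed (euclid R d2)}.
Variables (T : set (carrier G)) (C : nat -> set (carrier G)) (x0 : 'cV[R]_d).
Variables (Rg : set (carrier G)).
Hypothesis hGS : normal_form G S.
Hypothesis hT : translation_lift S T.
Hypothesis hC : forall N, M0 T N -> representatives (powers T N) (C N).
Hypothesis hRg : admissible x0 Rg.
Implicit Types (g h : carrier G) (u v : carrier G -> 'cV[R]_d) (K : set 'M[R]_d).

Let stab_fin : finite_set (stab (G := G) x0).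
Proof. by apply: finite_stab; case: hGS. Qed.

Let Rgfin : finite_set Rg. Proof. by case: hRg. Qed.

Let Rgstab : [set (g * h)%g | g in Rg & h in stab x0] = Rg.
Proof. by case: hRg. Qed.

Lemma skew_subspace : subspace (@skew_mx R d).
Proof.
split; first by rewrite /skew_mx /= trmx0 oppr0.
move=> a A B; rewrite /skew_mx /= => hA hB.
by rewrite linearD linearZ /= hA hB scalerN opprD.
Qed.

Lemma skew00_subspace : subspace (@skew00_mx R d1 d2).
Proof.
have [s0 sD] := skew_subspace; split.
  by split => //; exists 0; rewrite block_mx_const.
move=> a A B [hA [A1 eA]] [hB [B1 eB]]; split; first exact: sD.
by exists (a *: A1 + B1); rewrite eA eB scale_block_mx add_block_mx !scaler0 !addr0.
Qed.

Definition local_defect K u g : R :=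
  norm_on Rg (proj_ker Rg (Uiso Rg K x0) (shift g u \_ Rg)).

Lemma local_defect_ge0 K u g : 0 <= local_defect K u g.
Proof. exact: norm_on_ge0. Qed.

Lemma local_defect_periodic N K u g t : M0 T N -> periodic_wrt T N u -> powers T N t ->
  local_defect K u (g * t)%g = local_defect K u g.
Proof.
by move=> hN pu Pt; rewrite /local_defect /shift (periodic_shift g hN pu Pt).
Qed.

Lemma seminormE N K u : M0 T N -> periodic_wrt T N u ->
  seminorm Rg T C K x0 u = Num.sqrt (coset_mean (C N) (fun g => local_defect K u g ^+ 2)).
Proof.
move=> hN pu; congr Num.sqrt; apply: (period_mean_eq hGS hT hC hN pu).
move=> N' hN' pu' g t Pt; have := local_defect_periodic K g hN' pu' Pt.
by rewrite /local_defect /shift => ->.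
Qed.

(** A smaller [K] gives a smaller kernel, hence a longer projection; so bounds in the seminorm for
    [skew_mx] carry over to [skew00_mx]. *)
Lemma local_defect_le K u g : subspace K -> K `<=` skew_mx ->
  local_defect skew_mx u g <= local_defect K u g.
Proof.
move=> sK Kskew; apply: norm_proj_ker_le => //.
- exact: Uiso_subspace skew_subspace.
- exact: Uiso_subspace.
- by move=> w [wR [a [A KA hA]]]; split => //; exists a; exists A => //; exact: Kskew.
- by move=> w [].
- exact: patch_maps_on.
Qed.

Lemma seminorm_le K u : subspace K -> K `<=` skew_mx -> Uper T u ->
  seminorm Rg T C skew_mx x0 u <= seminorm Rg T C K x0 u.
Proof.
move=> sK Kskew [N hN pu]; rewrite !(seminormE _ hN pu); apply: ler_wsqrtr.
apply: ler_coset_mean => [|g _]; first exact: (finite_C hGS hT hC hN).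
by rewrite ler_pXn2r ?nnegrE ?local_defect_ge0// local_defect_le.
Qed.

Section Displacements.
Variable RV : set (cosets_star G x0).
Hypothesis RVfin : finite_set RV.

Lemma displacement_bound : exists2 c : R, 0 <= c & exists s : seq (carrier G),
  forall u g, exists2 A, skew_mx A &
    supnorm (local_displacement RV u g - range_mul RV A (y0 G x0)) <=
      c * \sum_(j <- s) local_defect skew_mx u (g * j)%g.
Proof.
case: hRg => _ _ [R1 [R2 [R12 one12 R1gen R2aff]]].
pose reps := [seq coset_rep c | c <- fset_set RV].
have [c c0 [s hs]] := rigidity R12 one12 R1gen R2aff reps.
(* From left to right: passing to the supremum norm, rotating back by [L(g)^-1], rigidity, rotating
   the patch by [L(k)], and the local approximation. *)
exists (d%:R * (d%:R * (c * (d%:R * d%:R)))); first by rewrite !mulr_ge0.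
exists s => u g.
have /choice[aS aSP] : forall g, exists aS : 'cV[R]_d * 'M[R]_d, skew_mx aS.2 /\
    forall h, Rg h -> `|coset_field x0 (shift g u) h - (aS.1 + aS.2 *m (act (val h) x0 - x0))|
      <= d%:R * local_defect skew_mx u g.
  move=> k; have [a [A hA hl]] := local_approximation stab_fin Rgfin Rgstab (shift k u) skew_subspace.
  by exists (a, A).
(* Conjugation by [L(k)] and a shift of the base point rewrite the isometry found on the patch at
   [k] as an affine map on orbit points. *)
pose Sg k := lin (val k) *m (aS k).2 *m (lin (val k))^T.
pose ag k := lin (val k) *m (aS k).1 - Sg k *m act (val k) x0.
have SgE k x : Sg k *m (act (val k) x - act (val k) x0) = lin (val k) *m ((aS k).2 *m (x - x0)).
  by rewrite actB /Sg -!mulmxA (mulmxA (lin (val k))^T) linP mul1mx.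
have hpatch : patchwise_affine x0 Rg (fun k => d%:R * (d%:R * local_defect skew_mx u k))
    (coset_field x0 u) ag Sg.
  move=> k h Rh; have -> : ag k + Sg k *m act (val (k * h)%g) x0 =
      lin (val k) *m ((aS k).1 + (aS k).2 *m (act (val h) x0 - x0)).
    rewrite [RHS]mulmxDr -SgE mulmxBr valM act_mul /ag.
    by rewrite -addrA; congr (_ + _); rewrite addrC.
  rewrite coset_field_shift -mulmxBr; apply: le_trans (norm_lin _ _) _.
  by rewrite ler_wpM2l//; exact: (aSP k).2.
exists (aS g).2; first exact: (aSP g).1.
set t := \sum_(j <- s) _.
have t0 : 0 <= t by apply: sumr_ge0 => j _; exact: local_defect_ge0.
rewrite -mulrA; apply: supnorm_le_norm; first by rewrite !mulr_ge0.
move=> k; rewrite fctB range_mulE /local_displacement patchE0.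
case: ifPn => [/set_mem RVk|_]; last by rewrite subrr normr0 !mulr_ge0.
have hr : coset_rep k \in reps by apply: map_f; rewrite in_fset_set// inE.
have := hs _ _ _ _ hpatch g _ hr; rewrite -!mulr_sumr -/t.
rewrite !coset_field_shift valM act_mul SgE -[coset_field x0 u g](congr1 (coset_field x0 u) (mulg1 g)).
rewrite coset_field_shift -!mulmxBr => le1.
have -> : displacement x0 (shift g u) k - (aS g).2 *m y0 G x0 k =
    lin (val g)^-1%g *m (lin (val g) *m (coset_field x0 (shift g u) (coset_rep k) -
      coset_field x0 (shift g u) 1%g - (aS g).2 *m (act (val (coset_rep k)) x0 - x0))).
  by rewrite mulmxA lin_inv linP mul1mx.
apply: le_trans (norm_lin _ _) _; rewrite -!mulrA ler_wpM2l//.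
Qed.

End Displacements.

(** Squaring the sum costs one factor [size s]; the other counts the summands, whose means coincide
    by translation invariance. *)
Lemma mean_sum_defect N u (s : seq (carrier G)) : M0 T N -> periodic_wrt T N u ->
  Num.sqrt (coset_mean (C N) (fun g => (\sum_(j <- s) local_defect skew_mx u (g * j)%g) ^+ 2)) <=
  (size s)%:R * seminorm Rg T C skew_mx x0 u.
Proof.
move=> hN pu; have fC := finite_C hGS hT hC hN.
rewrite (seminormE _ hN pu); set m := coset_mean (C N) (fun g => local_defect skew_mx u g ^+ 2).
have -> : (size s)%:R = Num.sqrt ((size s)%:R ^+ 2) :> R by rewrite sqrtr_sqr ger0_norm.
rewrite -sqrtrM ?sqr_ge0//; apply: ler_wsqrtr.
apply: (@le_trans _ _ (coset_mean (C N)
    (fun g => (size s)%:R * \sum_(j <- s) local_defect skew_mx u (g * j)%g ^+ 2))).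
  by apply: ler_coset_mean => // g _; exact: sqr_sum_le.
rewrite coset_meanZ// expr2 -mulrA ler_wpM2l// coset_mean_sum//.
have -> : (size s)%:R * m = \sum_(j <- s) m.
  by rewrite big_const_seq count_predT iter_addr_0 mulr_natl.
apply: ler_sum => j _.
have F_per g t : powers T N t ->
    local_defect skew_mx u (g * t)%g ^+ 2 = local_defect skew_mx u g ^+ 2.
  by move=> Pt; rewrite (local_defect_periodic skew_mx g hN pu Pt).
by have -> := coset_mean_translate j hN.2 (hC hN) F_per.
Qed.

(* A bump supported on a sparse sublattice is not a local infinitesimal isometry. *)
Lemma seminorm_gt0 : orbit_of x0 [set: carrier G] <> [set x0] ->
  exists2 u, Uper T u & 0 < seminorm Rg T C skew_mx x0 u.
Proof.
move=> hx0; case: hRg => _ _ [R1 [R2 [R12 [one1 one2] R1gen R2aff]]].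
have Rg_R2 h : R2 h -> Rg h.
  by move=> h2; apply: R12; exists 1%g => //; exists h => //; rewrite mul1g.
(* If all of [Rg] fixed [x0], the orbit under [R2] and thus the affine hull of the full orbit would
   be a single point. *)
have [g Rgg gx0] : exists2 g, Rg g & act (val g) x0 <> x0.
  apply: contrapT => noex; apply: hx0; apply/seteqP; split => [x [g _ <-]|x ->]; last first.
    by exists 1%g => //; exact: act_one.
  have : aff (orbit_of x0 [set: carrier G]) (act (val g) x0).
    exists 1%N, (fun=> 1), (fun=> act (val g) x0); split.
    - by move=> _; exists g.
    - by rewrite big_ord1.
    - by rewrite big_ord1 scale1r.
  rewrite -R2aff => -[m [c [p [pR2 c1 ->]]]] /=.
  have px0 i : p i = x0.
    have [q Rq <-] := pR2 i; apply: contrapT => qx0; apply: noex.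
    by exists q => //; exact: Rg_R2.
  by under eq_bigr do rewrite px0; rewrite -scaler_suml c1 scale1r.
have [N hN gN] := M0_avoid hGS hT gx0.
(* The height of the bump equals the displacement of [x0] under [g], so that pairing with [e] turns
   the rotation term into [e^T A e = 0]. *)
pose e := act (val g) x0 - x0.
pose u k : 'cV[R]_d := if k \in powers T N then e else 0.
have [P1 PM PV] := M0_subgroup hN.
have pu : periodic_wrt T N u.
  move=> k t Pt; rewrite /u; have -> // : ((k * t)%g \in powers T N) = (k \in powers T N).
  apply/idP/idP; rewrite !inE => h; last exact: PM.
  by rewrite -(mulgK t k); apply: PM => //; exact: PV.
exists u; first by exists N.
have fC := finite_C hGS hT hC hN.
rewrite (seminormE _ hN pu) sqrtr_gt0 lt0r coset_mean_ge0 ?andbT; last 2 first.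
- exact: fC.
- by move=> k; exact: sqr_ge0.
apply/negP => /eqP mean0.
have defect0 : local_defect skew_mx u 1%g = 0.
  have [c [[Cc [t Pt ct]] _]] := hC hN 1%g; rewrite mul1g in ct.
  have <- : local_defect skew_mx u c = local_defect skew_mx u 1%g.
    by rewrite ct -(local_defect_periodic skew_mx 1%g hN pu Pt) mul1g.
  apply/eqP; rewrite -sqrf_eq0; apply/eqP.
  have cX : c \in fset_set (C N) by rewrite in_fset_set// inE.
  move: mean0; rewrite coset_mean_fset// => /eqP; rewrite mulf_eq0 invr_eq0 pnatr_eq0.
  rewrite cardfs_eq0 => /orP[/eqP X0|/eqP]; first by rewrite X0 in_fset0 in cX.
  rewrite big_seq_fsetE /= => /psumr_eq0P H.
  by apply: (H _ [` cX]%fset) => // i _; exact: sqr_ge0.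
have [a [A skA hA]] := local_approximation stab_fin Rgfin Rgstab (shift 1%g u) skew_subspace.
rewrite -/(local_defect skew_mx u 1%g) defect0 mulr0 in hA.
have {}hA h : Rg h -> coset_field x0 u h = a + A *m (act (val h) x0 - x0).
  move=> /hA; rewrite normr_le0 subr_eq0 => /eqP <-; congr (_ *m _).
  by apply: eq_stab_mean => h' _; rewrite /shift mul1g.
pose n0 : R := #|` fset_set (stab (G := G) x0)|%:R.
have n0_gt0 : 0 < n0 by exact: card_stab_gt0.
(* Only the identity of the stabilizer lies in [T^N], so the mean meets the bump exactly once. *)
have u1 : coset_field x0 u 1%g = n0^-1 *: e.
  rewrite /coset_field [lin _]lin_one mul1mx /ubar /stab_mean -/n0; congr (_ *: _).
  rewrite (fsbigD1 1%g)//; last exact: stab1.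
  rewrite fsbig1 => [|h [hs h1]]; last first.
    rewrite /u mul1g ifF ?mulmx0//; apply/negbTE; rewrite notin_setE => Ph; apply: h1.
    exact: (powers_stab hGS hT hN Ph hs).
  by rewrite Monoid.mulm1 [lin _]lin_one mul1mx mulg1 /u mem_set.
have ug : coset_field x0 u g = 0.
  rewrite /coset_field /ubar /stab_mean fsbig1 ?scaler0 ?mulmx0// => h hs.
  rewrite /u ifF ?mulmx0//; apply/negbTE; rewrite notin_setE; exact: gN.
have := hA 1%g (Rg_R2 _ one2); rewrite u1 [act _ x0]act_one subrr mulmx0 addr0 => ae.
have := hA g Rgg; rewrite ug -ae -/e => eq0.
(* The values at [1] and [g] give [e / n0 + A e = 0]; after pairing with [e] only the squared norm
   of [e] over [n0] survives. *)
have : (e^T *m (n0^-1 *: e)) 0 0 + (e^T *m (A *m e)) 0 0 = 0.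
  have addE (B B' : 'M[R]_1) : B 0 0 + B' 0 0 = (B + B') 0 0 by rewrite mxE.
  by rewrite addE -mulmxDr -eq0 mulmx0 mxE.
have -> : (e^T *m (n0^-1 *: e)) 0 0 = n0^-1 * fnorm e ^+ 2.
  by rewrite -scalemxAr mxE sqr_fnorm_dot.
have -> : (e^T *m (A *m e)) 0 0 = 0.
  have : (e^T *m (A *m e))^T = - (e^T *m (A *m e)).
    by rewrite !trmx_mul trmxK (skA : A^T = - A) mulmxN mulNmx mulmxA.
  move=> /matrixP/(_ 0 0); rewrite [LHS]mxE [RHS]mxE; lra.
rewrite addr0 => /eqP; rewrite mulf_eq0 invr_eq0 gt_eqF//= sqrf_eq0 => /eqP fe0.
apply: gx0; apply/eqP; rewrite -subr_eq0 -/e -normr_le0 -fe0; exact: norm_le_fnorm.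
Qed.

Variable V : (cosets_star G x0 -> 'cV[R]_d) -> R.
Hypothesis hV : interaction_potential V.
Hypothesis hrange : finite_range V.
Hypothesis hequil : forall z, Linfty z -> dV V (y0 G x0) z = 0.

Lemma energy2_bounded :
  bounded_form (Uper T) (seminorm Rg T C skew_mx x0) (energy2 V T C).
Proof.
have [RV RVfin V_range] := hrange.
have [V_rot V_C2 _] := hV.
have [k k0 hk] := hessian_bound V_rot RVfin V_range (V_C2 (y0 G x0)) hequil.
have [c c0 [s hs]] := displacement_bound RVfin.
pose n : R := (size s)%:R.
exists (k * c ^+ 2 * n ^+ 2 + 1); first by rewrite ltr_wpDl// !mulr_ge0 ?sqr_ge0// ltW.
move=> u v Uu Uv; have [N [hN pu pv]] := common_period hGS hT Uu Uv.
have fC := finite_C hGS hT hC hN.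
apply: le_trans (energy2_le hGS hT hC hV RVfin V_range hequil hN pu pv) _.
have step (X Y a b : R) : 0 <= X -> 0 <= Y -> X <= c * a -> Y <= c * b ->
    k * X * Y <= k * c ^+ 2 * (a * b).
  move=> X0 Y0 Xa Yb; have -> : k * c ^+ 2 * (a * b) = k * (c * a) * (c * b) by ring.
  have kX : 0 <= k * X by rewrite mulr_ge0// ltW.
  by apply: ler_pM => //; rewrite ler_wpM2l// ltW.
pose F w g := \sum_(j <- s) local_defect skew_mx w (g * j)%g.
apply: (@le_trans _ _ (coset_mean (C N) (fun g => k * c ^+ 2 * (F u g * F v g)))).
  apply: ler_coset_mean => // g _.
  have [A skA hA] := hs u g; have [A' skA' hA'] := hs v g.
  have Lw w : Linfty (local_displacement RV w g) by exact: local_displacement_Linfty.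
  have L1 w (E : 'M[R]_d) : Linfty (local_displacement RV w g - range_mul RV E (y0 G x0)).
    exact: (subspaceB (@Linfty_subspace R d _) (Lw w) (range_mul_Linfty RVfin E (y0 G x0))).
  apply: le_trans (hk A A' _ _ skA skA' (Lw u) (Lw v)) _.
  exact: (step _ _ _ _ (supnorm_ge0 (L1 u A)) (supnorm_ge0 (L1 v A')) hA hA').
rewrite coset_meanZ//.
set nu := seminorm _ _ _ _ _ u; set nv := seminorm _ _ _ _ _ v.
have nu0 : 0 <= nu by exact: sqrtr_ge0.
have nv0 : 0 <= nv by exact: sqrtr_ge0.
apply: (@le_trans _ _ (k * c ^+ 2 * (n * nu * (n * nv)))).
  rewrite ler_wpM2l ?mulr_ge0 ?sqr_ge0 ?(ltW k0)//.
  apply: le_trans (coset_mean_cauchy_schwarz _ _ fC) _.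
  by apply: ler_pM; rewrite ?sqrtr_ge0//; exact: mean_sum_defect.
have -> : k * c ^+ 2 * (n * nu * (n * nv)) = k * c ^+ 2 * n ^+ 2 * nu * nv by ring.
by clearbody nu nv; rewrite ler_wpM2r// ler_wpM2r// lerDl.
Qed.

(** The energy bound and the test field for [skew_mx] serve every such [K], since the seminorm for
    [K] dominates. *)
Lemma lambda_a_fin_num K : subspace K -> K `<=` skew_mx ->
  orbit_of x0 [set: carrier G] <> [set x0] -> lambda_a V T C Rg K \is a fin_num.
Proof.
move=> sK Kskew hx0; have [c c0 hc] := energy2_bounded.
apply: (ereal_sup_ratio_fin_num c0 (fun v Wv => hc v v Wv Wv) _ (seminorm_gt0 hx0)).
by move=> v Uv; apply/andP; split; [exact: sqrtr_ge0|exact: seminorm_le].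
Qed.

End Boundedness.

Theorem theorem3p18 (R : realType) (d1 d2 daff : nat)
    (G : groupClosed (euclid R (d1 + d2))) (S : groupClosed (euclid R d2))
    (T : set (carrier G)) (C : nat -> set (carrier G))
    (x0 : 'cV[R]_(d1 + d2))
    (V : (cosets_star G x0 -> 'cV[R]_(d1 + d2)) -> R)
    (Rg : set (carrier G))
    (hGS : normal_form G S)
    (hT : translation_lift S T)
    (hC : forall N, M0 T N -> representatives (powers T N) (C N))
    (hcoord : normalized_coordinates G x0 daff)
    (hx0 : orbit_of x0 [set: carrier G] <> [set x0])
    (hV : interaction_potential V)
    (hrange : finite_range V)
    (hRg : admissible x0 Rg)
    (hequil : forall z, Linfty z -> dV V (y0 G x0) z = 0) :
  [/\ bounded_form (Uper T) (seminorm Rg T C skew_mx x0) (energy2 V T C),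
      lambda_a V T C Rg skew_mx \is a fin_num &
      lambda_a V T C Rg skew00_mx \is a fin_num].
Proof.
split; first exact: (energy2_bounded hGS hT hC hRg hV hrange hequil).
  exact: (lambda_a_fin_num hGS hT hC hRg hV hrange hequil skew_subspace).
apply: (lambda_a_fin_num hGS hT hC hRg hV hrange hequil skew00_subspace) => //.
by move=> A [].
Qed.
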